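(* There exist a smooth irreducible algebraic hypersurface $H\subset\mathbb{C}^5$ and an algebraic action $\mu$ of the additive group $(\mathbb{C},+)$ on $H$ such that for every $t\in\mathbb{C}$ with $t\neq 0$ there exists neither an algebraic automorphism nor a holomorphic automorphism $\phi$ of $\mathbb{C}^5$ with $\phi|_H=\mu(t)$.
   Context: $\mathbb{C}^5$ is the set of complex points of the affine space $\mathbb{A}^5$ over $\mathbb{C}$. An algebraic action of $(\mathbb{C},+)$ on $H$ is a group action for which the map $\mathbb{C}\times H\to H$, $(t,x)\mapsto\mu(t)(x)$, is a morphism of algebraic varieties. An algebraic automorphism of $\mathbb{C}^5$ is a polynomial map with polynomial inverse; a holomorphic automorphism is a biholomorphic self-map. *)

(* Defs.v *)
(* The field C of complex numbers is R[i] for a realType R; the definitions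
   below only use that it is a numClosedFieldType. *)
From HB Require Import structures.
From mathcomp Require Import all_boot all_order all_algebra mpoly.
From mathcomp Require Import boolp classical_sets topology normedtype.
From mathcomp Require Import derive.

Set Implicit Arguments.
Unset Strict Implicit.
Unset Printing Implicit Defensive.

Import Order.TTheory GRing.Theory Num.Theory.
Import numFieldNormedType.Exports.

Local Open Scope classical_set_scope.
Local Open Scope ring_scope.

(* A polynomial f is evaluated at the point x of C^n as f.@[x 0], where
   x 0 : 'I_n -> C is the only row of x. *)

Definition irreducible_mpoly (C : numClosedFieldType) (n : nat)
    (f : {mpoly C[n]}) : Prop :=
  [/\ f != 0, f \isn't a GRing.unit &
      forall g h : {mpoly C[n]}, f = g * h ->
        g \is a GRing.unit \/ h \is a GRing.unit].

(* An irreducible f generates the ideal of its zero locus, so that smoothness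
   of the hypersurface is the Jacobian criterion for f alone. *)
Definition smooth_irreducible_hypersurface (C : numClosedFieldType) (n : nat)
    (H : set 'rV[C]_n) : Prop :=
  exists f : {mpoly C[n]},
    [/\ irreducible_mpoly f,
        H = [set x | f.@[x 0] = 0] &
        forall x, H x -> exists i : 'I_n, (f^`M(i)).@[x 0] != 0].

Definition polynomial_map (C : numClosedFieldType) (m n : nat)
    (F : 'rV[C]_m -> 'rV[C]_n) : Prop :=
  exists P : 'I_n -> {mpoly C[m]},
    forall (x : 'rV[C]_m) (j : 'I_n), F x 0 j = (P j).@[x 0].

(* Only the values of mu t on H matter.  As C x H is closed in C^(1 + n), the
   morphisms from C x H to H are the restrictions of polynomial maps on
   C^(1 + n), whose points (t, x) are written row_mx t%:M x. *)
Definition algebraic_additive_action (C : numClosedFieldType) (n : nat)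
    (H : set 'rV[C]_n)
    (mu : C -> 'rV[C]_n -> 'rV[C]_n) : Prop :=
  [/\ forall t x, H x -> H (mu t x),
      forall x, H x -> mu 0 x = x,
      forall s t x, H x -> mu (s + t) x = mu s (mu t x) &
      exists2 F : 'rV[C]_(1 + n) -> 'rV[C]_n, polynomial_map F &
        forall t x, H x -> mu t x = F (row_mx t%:M x)].

Definition algebraic_automorphism (C : numClosedFieldType) (n : nat)
    (phi : 'rV[C]_n -> 'rV[C]_n) : Prop :=
  exists psi : 'rV[C]_n -> 'rV[C]_n,
    [/\ polynomial_map phi, polynomial_map psi,
        cancel phi psi & cancel psi phi].

(* Here differentiable is over the field C, i.e. the differential at each
   point is C-linear. *)
Definition holomorphic_map (C : numClosedFieldType) (m n : nat)
    (F : 'rV[C]_m -> 'rV[C]_n) : Prop :=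
  forall x : 'rV[C]_m, differentiable F x.

Definition holomorphic_automorphism (C : numClosedFieldType) (n : nat)
    (phi : 'rV[C]_n -> 'rV[C]_n) : Prop :=
  exists psi : 'rV[C]_n -> 'rV[C]_n,
    [/\ holomorphic_map phi, holomorphic_map psi,
        cancel phi psi & cancel psi phi].

(* Main.v *)
Require Import Defs.
From mathcomp Require Import all_boot all_order all_algebra complex mpoly.
From mathcomp Require Import ring lra.
From mathcomp Require Import mathcomp_extra boolp classical_sets functions reals.
From mathcomp Require Import interval_inference constructive_ereal ereal.
From mathcomp Require Import topology normedtype derive sequences realfun exp.
From mathcomp Require Import measure lebesgue_measure lebesgue_integral ftc.

(* On C^5 with coordinates b, x, y, z, u, put a = b (b - 1), f0 = 1 + b a^10, v = f0 y - x z, s = x v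
   and f = 1 + b (a (1 + a s))^10, and let H be {f = 0}.  As f = f0 + x C with C a polynomial in b, x
   and v, the map mu t : (b, x, y, z, u) |-> (b, x, y + t, z - t C, u) sends v to v + t f, so that mu
   is an action on H, along which b and s are invariant.

   Since f = 1 + b^11 ((b - 1) (1 + a s))^10, the function f takes the value 1 only with high
   multiplicity along entire curves, and a theorem of Picard type shows that b is constant on an entire
   curve that avoids H.  For c distinct from 0 and 1, an entire curve in {b = c} that avoids H moreover
   has constant s, because f = 0 has at least two solutions s.  Let F be a holomorphic automorphism that
   extends mu t; it preserves the complement of H.  The slices b = 0 and b = 1 avoid H, hence b o F is
   constant on each, with a value in {0, 1}: for any other value s o F would be constant too, and F would
   send the slice into the critical locus x = 0 of s on a slice.  Consequently b o F omits 0 and 1 on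
   every other slice b = c, which F therefore preserves, as it fixes b on H.  If f0(c) <> 0, the
   coordinate lines of the slice through p_c = (c, 0, 0, 0, 0) lie in {s = 0} and avoid H, so that F p_c
   is a critical point of s on its slice, which means that x = y = 0 at F p_c.  By continuity y (F p_c) =
   0 also when f0(c) = 0.  But then p_c is in H, where F is mu t and y (F p_c) = t.

   The Picard theorem is proved with a metric of negative curvature (Ahlfors): a maximum principle on the
   disc of radius r bounds its density at the center by a multiple of r^-2.

   For the irreducibility of f, the part x <> 0 of H has a rational parametrization, so that one of the
   factors vanishes on it; the smoothness of H forces the other factor to have no zero at all. *)
Set Implicit Arguments.
Unset Strict Implicit.
Unset Printing Implicit Defensive.

Import Order.TTheory GRing.Theory Num.Theory.
Import numFieldNormedType.Exports.
Import ComplexField.Normc.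

Local Open Scope classical_set_scope.
Local Open Scope ring_scope.
Local Open Scope complex_scope.

Local Notation Re := complex.Re.
Local Notation Im := complex.Im.
Local Arguments ComplexField.Normc.normc : simpl never.

(** * Derivatives *)

Section ComplexDerivative.
Variable K : numFieldType.
Implicit Types (E F : K -> K) (z d : K).

(** One notion serves for real differentiation over [R] and for complex differentiation over [R[i]].
    The relational form carries existence and value of the derivative together. *)
Definition cder E z d : Prop := is_derive z (1 : K) E d.
Definition cD E z : K := 'D_(1 : K) E z.

Lemma cderD1 E z d : cder E z d -> cD E z = d.
Proof. by case. Qed.

Lemma cder_ext E F z d : E =1 F -> cder E z d -> cder F z d.
Proof. by move=> /funext ->. Qed.

Lemma cder_cst (c : K) z : cder (fun=> c) z 0.
Proof. exact: is_derive_cst. Qed.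

Lemma cder_id z : cder id z 1.
Proof. exact: is_derive_id. Qed.

Lemma cderD E F z d d' :
  cder E z d -> cder F z d' -> cder (fun w => E w + F w) z (d + d').
Proof. by move=> h1 h2; exact: is_deriveD. Qed.

Lemma cderN E z d : cder E z d -> cder (fun w => - E w) z (- d).
Proof. by move=> h1; exact: is_deriveN. Qed.

Lemma cderB E F z d d' :
  cder E z d -> cder F z d' -> cder (fun w => E w - F w) z (d - d').
Proof. by move=> h1 h2; exact: is_deriveB. Qed.

Lemma cderM E F z d d' : cder E z d -> cder F z d' ->
  cder (fun w => E w * F w) z (d * F z + E z * d').
Proof.
move=> h1 h2; have := @is_deriveM _ _ _ _ _ _ _ _ h1 h2.
by rewrite /cder addrC /GRing.scale /= (mulrC (F z)).
Qed.

Lemma cderX E n z d : cder E z d ->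
  cder (fun w => E w ^+ n.+1) z (n.+1%:R * E z ^+ n * d).
Proof.
move=> h1; elim: n => [|n IH]; first by rewrite expr0 !mul1r.
apply: (cder_ext (E := fun w => E w * E w ^+ n.+1)); first by move=> w; rewrite -exprS.
suff -> : n.+2%:R * E z ^+ n.+1 * d = d * E z ^+ n.+1 + E z * (n.+1%:R * E z ^+ n * d).
  exact: cderM.
by rewrite !exprS -(natr1 n.+1); ring.
Qed.

Lemma cderV E z d : E z != 0 -> cder E z d ->
  cder (fun w => (E w)^-1) z (- (d / E z ^+ 2)).
Proof.
move=> n0 h1; split.
  by apply: derivableV => //; case: h1.
rewrite deriveV//; last by case: h1.
by case: h1 => _ ->; rewrite /GRing.scale /= mulNr mulrC.
Qed.

(** The first-order expansion. Its bound is not strict, so that [h = 0] is allowed and no punctured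
    neighbourhood appears in later estimates. *)
Lemma cderP E z d : cder E z d <->
  forall e : K, 0 < e -> exists2 r : K, 0 < r &
    forall h, `|h| < r -> `|E (z + h) - E z - d * h| <= e * `|h|.
Proof.
have key h e : h != 0 -> (`|d - h^-1 * (E (h * 1 + z) - E z)| <= e)
    = (`|E (z + h) - E z - d * h| <= e * `|h|).
  move=> h0; rewrite mulr1 (addrC h) -ler_pdivrMr ?normr_gt0// -normfV -normrM distrC.
  by congr (`|_| <= _); field.
split.
- move=> [dE dEd] e e0; have /cvgrPdist_le /(_ e e0) := dE.
  rewrite /= near_withinE => /nbhs_norm0P [r /= r0 hr].
  exists r => // h hr'; have [->|h0] := eqVneq h 0.
    by rewrite addr0 subrr mulr0 subr0 !normr0 mulr0.
  by move: (hr h hr' h0); rewrite -/(derive E z 1) dEd -key.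
- move=> H.
  have cv : (fun h => h^-1 *: ((E \o shift z) (h *: 1) - E z)) @ 0^' --> d.
    apply/cvgrPdist_le => e e0; have [r r0 hr] := H e e0.
    near_simpl; rewrite near_withinE; near=> h => h0.
    rewrite /= key//; apply: hr; near: h; exact: (@nbhs0_lt K K).
  split; first by apply/cvg_ex; exists d.
  exact: cvg_lim.
Unshelve. all: by end_near. Qed.

Lemma cder_comp E F z d d' : cder E (F z) d -> cder F z d' ->
  cder (fun w => E (F w)) z (d * d').
Proof.
move=> [dE dEd] [dF dFd].
have DE : differentiable E (F z) by apply/derivable1_diffP.
have DF : differentiable F z by apply/derivable1_diffP.
have DC : differentiable (E \o F) z by exact: differentiable_comp.
split; first by apply/derivable1_diffP.
have dE1 : 'd E (F z) = ( *:%R^~ d) :> (K -> K) by rewrite -dEd -derive1E -deriv1E.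
have dF1 : 'd F z = ( *:%R^~ d') :> (K -> K) by rewrite -dFd -derive1E -deriv1E.
apply: (etrans (deriveE _ DC)); apply: (etrans (congr1 (fun L : K -> K => L 1) (diff_comp DF DE))).
apply: (etrans (congr1 (fun L : K -> K => L ('d F z 1)) dE1)).
apply: (etrans (congr1 (fun L : K -> K => L 1 *: d) dF1)).
by rewrite /GRing.scale /= mul1r mulrC.
Qed.

Lemma cder_near E F z d (r : K) : 0 < r ->
  (forall w, `|w - z| < r -> E w = F w) -> cder E z d -> cder F z d.
Proof.
move=> r0 EF /cderP H; apply/cderP => e e0; have [s s0 hs] := H e e0.
have /andP[sr rr] : (0 < r <= r) by rewrite r0 lexx.
(* The order of [K] may be partial; [s] and [r] are comparable because positive elements are
   real. *)
have [m [m0 ms mr]] : exists m : K, [/\ 0 < m, m <= s & m <= r].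
  have : (s >=< r)%R by apply: real_comparable; exact: gtr0_real.
  by case/orP => h; [exists s|exists r].
exists m => // h hm; rewrite -!EF ?subrr ?normr0// ?(addrC z) ?addrK; last first.
  exact: lt_le_trans mr.
by rewrite addrC; apply: hs; exact: lt_le_trans ms.
Qed.

Lemma cder_lipschitz E z d : cder E z d ->
  exists2 r : K, 0 < r & forall h, `|h| < r -> `|E (z + h) - E z| <= (1 + `|d|) * `|h|.
Proof.
move=> /cderP /(_ 1 ltr01) [r r0 hr]; exists r => // h hh.
rewrite -[X in `|X|](subrK (d * h)); apply: le_trans (ler_normD _ _) _.
by rewrite mulrDl normrM lerD2r; exact: hr.
Qed.
End ComplexDerivative.

(** * Moduli, and restriction of complex functions to real lines *)

Section ComplexPlane.
Variable R : realType.
Local Notation C := R[i].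
Implicit Types (E F : C -> C) (z d h : C).

Lemma normcE0 z : `|z| = (normc z)%:C.
Proof. by case: z => a b; rewrite normc_def. Qed.

Lemma normc_ge0 z : 0 <= normc z.
Proof. by case: z => a b; exact: sqrtr_ge0. Qed.

Lemma normcB z h : normc (z - h) = normc (h - z).
Proof. by rewrite -normcN opprB. Qed.

Lemma normc_gt0 z : (0 < normc z) = (z != 0).
Proof. by rewrite -normr_gt0 normcE0 ltcR. Qed.

Lemma normc_Re z : `|Re z| <= normc z.
Proof. by rewrite -lecR -normcE0; exact: normc_ge_Re. Qed.

Lemma normc_Im z : `|Im z| <= normc z.
Proof.
case: z => a b; rewrite /normc /= -sqrtr_sqr ler_sqrt ?addr_ge0 ?sqr_ge0//.
by rewrite lerDr sqr_ge0.
Qed.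

Lemma normc_real (t : R) : normc t%:C = `|t|.
Proof. by rewrite /normc /= expr0n addr0 sqrtr_sqr. Qed.

Lemma normc_imag (t : R) : normc (0 +i* t) = `|t|.
Proof. by rewrite /normc /= expr0n add0r sqrtr_sqr. Qed.

Lemma normc_le_ReIm z : normc z <= `|Re z| + `|Im z|.
Proof.
case: z => a b; have := le_normcD a%:C (0 +i* b).
by rewrite normc_real normc_imag; congr (normc _ <= _); simpc.
Qed.

Lemma normcX z n : normc (z ^+ n) = normc z ^+ n.
Proof.
by elim: n => [|n IH]; rewrite ?expr0 ?normc1// !exprS normcM IH.
Qed.

Lemma normc_sqr z : normc z ^+ 2 = Re z ^+ 2 + Im z ^+ 2.
Proof. by case: z => a b; rewrite /normc sqr_sqrtr ?addr_ge0 ?sqr_ge0. Qed.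

Lemma posC_real (e : C) : 0 < e -> exists2 r : R, 0 < r & e = r%:C.
Proof.
case: e => a b; rewrite ltcE /= => /andP[/eqP -> a0]; by exists a.
Qed.

Lemma cderRP E z d : cder E z d <->
  forall e : R, 0 < e -> exists2 r : R, 0 < r &
    forall h, normc h < r -> normc (E (z + h) - E z - d * h) <= e * normc h.
Proof.
rewrite cderP; split => H e e0.
- have [|r r0 hr] := H e%:C; first by rewrite ltcR.
  have [s s0 rE] := posC_real r0; exists s => // h hs.
  have := hr h; rewrite rE !normcE0 ltcR -rmorphM/= lecR; exact.
- have [s s0 ->] := posC_real e0; have [r r0 hr] := H s s0.
  exists r%:C; first by rewrite ltcR.
  by move=> h; rewrite !normcE0 ltcR -rmorphM/= lecR; exact: hr.
Qed.

Definition ccont E := forall z (e : R), 0 < e -> exists2 r : R, 0 < r &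
    forall h, normc h < r -> normc (E (z + h) - E z) <= e.

Lemma cder_ccont E z d : cder E z d -> forall e : R, 0 < e -> exists2 r : R, 0 < r &
    forall h, normc h < r -> normc (E (z + h) - E z) <= e.
Proof.
move=> /cder_lipschitz[r r0 hr] e e0; have [s s0 rE] := posC_real r0.
have D0 : 0 < 1 + normc d by rewrite ltr_pwDl// normc_ge0.
exists (Num.min s (e / (1 + normc d))); first by rewrite lt_min s0 divr_gt0.
move=> h; rewrite lt_min => /andP[h1 h2].
have := hr h; rewrite rE !normcE0 ltcR => /(_ h1).
rewrite -(rmorph1 (real_complex R)) -rmorphD -rmorphM lecR => /le_trans; apply.
by rewrite mulrC -ler_pdivlMr// ltW.
Qed.

Lemma cderRe E z0 (th : C) (t : R) d : cder E (z0 + t%:C * th) d ->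
  cder (fun t : R => Re (E (z0 + t%:C * th))) t (Re (d * th)).
Proof.
move=> /cderRP H; apply/cderP => e e0.
(* The [+ 1] keeps the divisor positive when [th = 0]. *)
have T0 : 0 < normc th + 1 by rewrite ltr_wpDl// normc_ge0.
have [r r0 hr] := H (e / (normc th + 1)) (divr_gt0 e0 T0).
exists (r / (normc th + 1)); first exact: divr_gt0.
move=> h; rewrite ltr_pdivlMr// => hh.
have le1 : `|h| * normc th <= `|h| * (normc th + 1) by rewrite ler_wpM2l// lerDl.
have /hr : normc (h%:C * th) < r by rewrite normcM normc_real (le_lt_trans le1).
rewrite rmorphD/= mulrDl addrA normcM normc_real => H2.
have := le_trans (normc_Re _) H2; rewrite !raddfB/= => H3.
have eRe : Re (d * (h%:C * th)) = Re (d * th) * h.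
  by case: (d) (th) => a b [a' b']; rewrite /real_complex_def; simpc => /=; ring.
rewrite eRe in H3.
apply: le_trans H3 _.
by rewrite -mulrA ler_pM2l// ler_pdivrMl// [leRHS]mulrC.
Qed.
End ComplexPlane.

(** * Antiderivatives of continuous real functions *)

Section Antiderivative.
Variable R : realType.
Implicit Types (f g G : R -> R).

Lemma antiderivative_ray g (a : R) : continuous g ->
  exists G, forall x, a < x -> cder G x (g x).
Proof.
move=> cg.
exists (fun x => \int[lebesgue_measure]_(t in `[a, x]) (g t))%R => x ax.
have ig : lebesgue_measure.-integrable `[a, x + 1] (EFin \o g).
  apply: continuous_compact_integrable; first exact: segment_compact.
  exact/continuous_subspaceT.
have xu : x < x + 1 by rewrite ltrDl.
have [D1 D2] := continuous_FTC1_closed xu ig ax (cg x).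
by split; [exact: D1|exact: etrans (esym (derive1E _ _)) D2].
Qed.

Lemma cder_eq_cst (f g : R -> R) (d : R -> R) (a b : R) :
  (forall x, x \in `]a, b[ -> cder f x (d x)) -> (forall x, x \in `]a, b[ -> cder g x (d x)) ->
  forall x y, x \in `]a, b[ -> y \in `]a, b[ -> f x - g x = f y - g y.
Proof.
move=> Hf Hg.
suff W x y : x < y -> x \in `]a, b[ -> y \in `]a, b[ -> f x - g x = f y - g y.
  move=> x y xI yI; have [xy|xy|->//] := ltgtP x y; first exact: W.
  by apply/esym/W.
move=> xy; rewrite !in_itv/= => /andP[ax xb] /andP[ay yb].
have D z : z \in `[x, y] -> is_derive z 1 (fun z => f z - g z) (0 : R).
  rewrite in_itv/= => /andP[xz zy]; rewrite -(subrr (d z)).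
  by apply: cderB; [apply: Hf|apply: Hg]; rewrite in_itv/= (lt_le_trans ax)// (le_lt_trans zy).
have [|z _] := MVT_segment (ltW xy) (fun z zI => D z (subset_itv_oo_cc zI)).
  by apply: derivable_within_continuous => z /D[].
by rewrite mul0r => /eqP; rewrite subr_eq0 => /eqP ->.
Qed.

(** An integral with a fixed lower bound is an antiderivative only to the right of that bound. One
    on [x > -1] and the reflection of another one are normalized to vanish at [0]; they agree on
    []-1, 1[] and are glued at [0]. *)
Lemma antiderivative_exists g : continuous g -> exists G, forall x, cder G x (g x).
Proof.
move=> cg; have [G1 H1] := antiderivative_ray (-1) cg.
have cg' : continuous (fun x => g (- x)).
  by move=> x; apply: (@continuous_comp _ _ _ -%R g); [exact: opp_continuous|exact: cg].
have [G2' H2'] := antiderivative_ray (-1) cg'.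
pose G2 x := - G2' (- x).
have H2 x : x < 1 -> cder G2 x (g x).
  move=> x1; have := H2' (- x); rewrite ltrN2 opprK => /(_ x1) h.
  have := cderN (cder_comp h (cderN (cder_id x))).
  by rewrite mulrN mulr1 opprK.
exists (fun x => if 0 < x then G1 x - G1 0 else G2 x - G2 0) => x.
have eq12 w : w \in `](-1), 1[ -> G1 w - G1 0 = G2 w - G2 0.
  move=> wI; apply/eqP; rewrite subr_eq addrAC -subr_eq; apply/eqP.
  suff : G1 w - G2 w = G1 0 - G2 0 by lra.
  apply: (cder_eq_cst (d := g) (a := -1) (b := 1)) => //; last by rewrite in_itv/=; lra.
  - by move=> y; rewrite in_itv/= => /andP[h _]; exact: H1.
  - by move=> y; rewrite in_itv/= => /andP[_ h]; exact: H2.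
have [x0|x0] := ltP (-1) x.
- apply: (cder_near (E := fun x => G1 x - G1 0) (r := x + 1)); first by rewrite -ltrBlDr sub0r.
    move=> w hw; have [//|w0] := ltP 0 w.
    apply: eq12; rewrite in_itv/=; move: hw; rewrite ltr_norml; lra.
  by rewrite -[g x]subr0; apply: cderB; [exact: H1|exact: cder_cst].
- apply: (cder_near (E := fun x => G2 x - G2 0) (r := 1)); first exact: ltr01.
    move=> w hw; have [w0|//] := ltP 0 w.
    by exfalso; move: hw; rewrite ltr_norml; lra.
  by rewrite -[g x]subr0; apply: cderB; [apply: H2; lra|exact: cder_cst].
Qed.
End Antiderivative.

(** * Integration and Cauchy's formula *)

Section Integral.
Variable R : realType.
Local Notation C := R[i].
Implicit Types (g G : R -> R) (h k H : R -> C) (E : C -> C).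

(* The integral of a continuous function is the increment of an antiderivative; [prim g] is the
   zero function when [g] has none. *)
Definition prim g : R -> R := xget (fun=> 0) [set G | forall x, cder G x (g x)].
Definition rint g a b := prim g b - prim g a.

Lemma primP g : continuous g -> forall x, cder (prim g) x (g x).
Proof.
move=> /antiderivative_exists[G HG]; rewrite /prim.
by case: xgetP => [G' _ //|/(_ G)]; case.
Qed.

Lemma rint_prim g G a b : continuous g -> (forall x, cder G x (g x)) ->
  rint g a b = G b - G a.
Proof.
move=> /primP Hp HG; rewrite /rint.
pose M := `|a| + `|b| + 1.
have := ler_norm a; have := ler_norm b; have := ler_norm (- a); have := ler_norm (- b).
rewrite !normrN => b1 a1 b2 a2; have := normr_ge0 a; have := normr_ge0 b => b0 a0.
have aI : a \in `](- M), M[ by rewrite in_itv/= /M; apply/andP; split; lra.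
have bI : b \in `](- M), M[ by rewrite in_itv/= /M; apply/andP; split; lra.
have := cder_eq_cst (fun x _ => Hp x) (fun x _ => HG x) aI bI; lra.
Qed.

Lemma rint_mvt g a b : continuous g -> a < b ->
  exists2 c, a <= c <= b & rint g a b = g c * (b - a).
Proof.
move=> /primP Hp ab.
have D x : x \in `]a, b[ -> is_derive x 1 (prim g) (g x) by move=> _; exact: Hp.
have Cn : {within `[a, b], continuous (prim g)}.
  by apply: derivable_within_continuous => x _; case: (Hp x).
have [c /subset_itv_oo_cc cI Hc] := MVT ab D Cn.
by exists c => //; move: cI; rewrite in_itv.
Qed.

Definition rcont h := continuous (fun t => Re (h t)) /\ continuous (fun t => Im (h t)).
Definition cint h a b : C := rint (fun t => Re (h t)) a b +i* rint (fun t => Im (h t)) a b.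

Lemma cint_cat h a b c : cint h a b + cint h b c = cint h a c.
Proof. by rewrite /cint /rint; simpc; congr (_ +i* _); ring. Qed.

(** The real and imaginary parts are bounded separately by the mean value theorem, whence the factor
    [2]; only the order of magnitude matters in the applications. *)
Lemma cint_bound h a b (M : R) : rcont h -> a <= b ->
  (forall t, a <= t <= b -> normc (h t) <= M) -> normc (cint h a b) <= 2 * M * (b - a).
Proof.
move=> [h1 h2]; rewrite le_eqVlt => /predU1P[<-|ab] HM.
  by rewrite /cint /rint !subrr mulr0 /normc expr0n addr0 sqrtr0.
apply: le_trans (normc_le_ReIm _) _.
have [c1 /HM I1 /= ->] := rint_mvt h1 ab; have [c2 /HM I2 /= ->] := rint_mvt h2 ab.
have ba : 0 <= b - a by lra.
rewrite !normrM (ger0_norm ba) -mulrDl ler_wpM2r//.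
have := le_trans (normc_Re _) I1; have := le_trans (normc_Im _) I2; lra.
Qed.

Lemma rcontD h k : rcont h -> rcont k -> rcont (fun t => h t + k t).
Proof.
move=> [a b] [c d]; split => t.
- rewrite (_ : (fun t => _) = (fun t => Re (h t) + Re (k t))); last first.
    by apply/funext => s; rewrite raddfD.
  by apply: continuousD; [exact: a|exact: c].
- rewrite (_ : (fun t => _) = (fun t => Im (h t) + Im (k t))); last first.
    by apply/funext => s; rewrite raddfD.
  by apply: continuousD; [exact: b|exact: d].
Qed.

Lemma rcontZ (c : C) h : rcont h -> rcont (fun t => c * h t).
Proof.
case: c => x y [a b]; split => t.
- rewrite (_ : (fun t => _) = (fun t => x * Re (h t) - y * Im (h t))); last first.
    by apply/funext => s; case: (h s) => ? ?; simpc.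
  by apply: cvgB; apply: cvgM; [exact: cvg_cst|exact: a|exact: cvg_cst|exact: b].
- rewrite (_ : (fun t => _) = (fun t => x * Im (h t) + y * Re (h t))); last first.
    by apply/funext => s; case: (h s) => ? ?; simpc.
  by apply: cvgD; apply: cvgM; [exact: cvg_cst|exact: b|exact: cvg_cst|exact: a].
Qed.

Lemma cintD h k a b : rcont h -> rcont k ->
  cint (fun t => h t + k t) a b = cint h a b + cint k a b.
Proof.
move=> ch ck; have [cs1 cs2] := rcontD ch ck; case: ch => h1 h2; case: ck => k1 k2.
rewrite /cint; simpc; congr (_ +i* _).
- rewrite (rint_prim (G := fun t => prim (fun t => Re (h t)) t + prim (fun t => Re (k t)) t))//.
    by rewrite /rint; ring.
  by move=> x; rewrite raddfD; apply: cderD; exact: primP.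
- rewrite (rint_prim (G := fun t => prim (fun t => Im (h t)) t + prim (fun t => Im (k t)) t))//.
    by rewrite /rint; ring.
  by move=> x; rewrite raddfD; apply: cderD; exact: primP.
Qed.

Lemma cintZ (c : C) h a b : rcont h -> cint (fun t => c * h t) a b = c * cint h a b.
Proof.
move=> ch; have [cs1 cs2] := rcontZ c ch; case: ch => h1 h2; case: c cs1 cs2 => x y cs1 cs2.
rewrite /cint; simpc; congr (_ +i* _).
- rewrite (rint_prim (G := fun t => x * prim (fun t => Re (h t)) t - y * prim (fun t => Im (h t)) t))//.
    by rewrite /rint; ring.
  move=> t; have -> : Re ((x +i* y) * h t) = (0 * prim (fun t => Re (h t)) t + x * Re (h t)) - (0 * prim (fun t => Im (h t)) t + y * Im (h t)).
    by case: (h t) => ? ?; simpc => /=; ring.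
  by apply: cderB; apply: cderM; [exact: cder_cst|exact: primP|exact: cder_cst|exact: primP].
- rewrite (rint_prim (G := fun t => x * prim (fun t => Im (h t)) t + y * prim (fun t => Re (h t)) t))//.
    by rewrite /rint; ring.
  move=> t; have -> : Im ((x +i* y) * h t) = (0 * prim (fun t => Im (h t)) t + x * Im (h t)) + (0 * prim (fun t => Re (h t)) t + y * Re (h t)).
    by case: (h t) => ? ?; simpc => /=; ring.
  by apply: cderD; apply: cderM; [exact: cder_cst|exact: primP|exact: cder_cst|exact: primP].
Qed.

Lemma cderIm E (z0 th : C) (t : R) d : cder E (z0 + t%:C * th) d ->
  cder (fun t : R => Im (E (z0 + t%:C * th))) t (Im (d * th)).
Proof.
(* The imaginary part of [E] is the real part of [- 'i * E], which reduces the claim to [cderRe]. *)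
have eIm (z : C) : Re (- 'i * z) = Im z by case: z => a b; simpc.
move=> H; have := cderRe (cderM (cder_cst (- 'i : C) _) H).
rewrite mul0r add0r -mulrA eIm; apply: cder_ext => s; exact: eIm.
Qed.

Lemma rcont_eps h : (forall t (e : R), 0 < e -> exists2 r : R, 0 < r &
    forall s, `|s| < r -> normc (h (t + s) - h t) <= e) -> rcont h.
Proof.
move=> H; split => t; apply/cvgrPdist_le => e e0; have [r r0 hr] := H t e e0;
  near=> s; rewrite distrC -raddfB/= -[in h s](subrK t s) (addrC _ t).
- by apply: le_trans (normc_Re _) _; apply: hr; rewrite distrC; near: s; exact: cvgr_dist_lt.
- by apply: le_trans (normc_Im _) _; apply: hr; rewrite distrC; near: s; exact: cvgr_dist_lt.
Unshelve. all: by end_near. Qed.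

Lemma rcont_line E (z0 th : C) : ccont E -> rcont (fun t => E (z0 + t%:C * th)).
Proof.
move=> cE; apply: rcont_eps => t e e0; have [r r0 hr] := cE (z0 + t%:C * th) e e0.
have T0 : 0 < normc th + 1 by rewrite ltr_wpDl// normc_ge0.
exists (r / (normc th + 1)); first exact: divr_gt0.
move=> s; rewrite ltr_pdivlMr// => hs.
rewrite rmorphD/= mulrDl addrA; apply: hr; rewrite normcM normc_real.
by apply: le_lt_trans hs; rewrite ler_wpM2l// lerDl.
Qed.

Lemma rcont_cder E (z0 th : C) :
  (forall t : R, exists d, cder E (z0 + t%:C * th) d) -> rcont (fun t => E (z0 + t%:C * th)).
Proof.
move=> dE; apply: rcont_eps => t e e0; have [d /cder_ccont /(_ e e0) [r r0 hr]] := dE t.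
have T0 : 0 < normc th + 1 by rewrite ltr_wpDl// normc_ge0.
exists (r / (normc th + 1)); first exact: divr_gt0.
move=> s; rewrite ltr_pdivlMr// => hs.
rewrite rmorphD/= mulrDl addrA; apply: hr; rewrite normcM normc_real.
by apply: le_lt_trans hs; rewrite ler_wpM2l// lerDl.
Qed.

Lemma cint_line E (G : C -> C) (z0 th : C) a b : rcont (fun t => E (z0 + t%:C * th)) ->
  (forall t : R, cder G (z0 + t%:C * th) (E (z0 + t%:C * th))) ->
  th * cint (fun t => E (z0 + t%:C * th)) a b = G (z0 + b%:C * th) - G (z0 + a%:C * th).
Proof.
move=> cE dG; rewrite -cintZ// /cint.
have [c1 c2] := rcontZ th cE.
rewrite (rint_prim (G := fun t : R => Re (G (z0 + t%:C * th))))//; last first.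
  by move=> t; rewrite mulrC; exact: cderRe.
rewrite (rint_prim (G := fun t : R => Im (G (z0 + t%:C * th))))//; last first.
  by move=> t; rewrite mulrC; exact: cderIm.
by case: (G _) => ? ?; case: (G _) => ? ?; simpc.
Qed.
End Integral.

(** * Goursat's theorem on rectangles *)

Section Goursat.
Variable R : realType.
Local Notation C := R[i].
Implicit Types (E F G : C -> C).

(** The factor [1] is the direction: horizontal and vertical edges then share the shape
    [z0 + t%:C * th] of the lemmas on lines. *)
Definition hline E (y t : R) : C := E ((0 +i* y) + t%:C * 1).
Definition vline E (x t : R) : C := E (x%:C + t%:C * 'i).
(** The contour integral along the boundary of the rectangle, counterclockwise. *)
Definition rect E (x0 x1 y0 y1 : R) : C :=
  cint (hline E y0) x0 x1 - cint (hline E y1) x0 x1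
  + 'i * (cint (vline E x1) y0 y1 - cint (vline E x0) y0 y1).
(** Continuity is asked along the whole lines that carry the edges, because [rint] rests on
    antiderivatives on all of [R]. *)
Definition edge_cont E (x0 x1 y0 y1 : R) := [/\ rcont (hline E y0),
  rcont (hline E y1), rcont (vline E x0) & rcont (vline E x1)].

Lemma hpoint (y t : R) : (0 +i* y) + t%:C * 1 = t +i* y :> C.
Proof. by simpc. Qed.

Lemma vpoint (x t : R) : x%:C + t%:C * 'i = x +i* t :> C.
Proof. by simpc. Qed.

Lemma ccont_edge E x0 x1 y0 y1 : ccont E -> edge_cont E x0 x1 y0 y1.
Proof. by move=> cE; split; exact: rcont_line. Qed.

Lemma ccontD E F : ccont E -> ccont F -> ccont (fun z => E z + F z).
Proof.
move=> cE cF z e e0; have e2 : 0 < e / 2 by rewrite divr_gt0.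
have [r r0 hr] := cE z _ e2; have [s s0 hs] := cF z _ e2.
exists (Num.min r s); first by rewrite lt_min r0.
move=> h; rewrite lt_min => /andP[/hr h1 /hs h2].
have -> : E (z + h) + F (z + h) - (E z + F z) = (E (z + h) - E z) + (F (z + h) - F z) by ring.
apply: le_trans (le_normcD _ _) _; lra.
Qed.

Lemma rect_hcat E x0 x1 x2 y0 y1 :
  rect E x0 x1 y0 y1 + rect E x1 x2 y0 y1 = rect E x0 x2 y0 y1.
Proof. by rewrite /rect -!(cint_cat _ x0 x1 x2); ring. Qed.

Lemma rect_vcat E x0 x1 y0 y1 y2 :
  rect E x0 x1 y0 y1 + rect E x0 x1 y1 y2 = rect E x0 x1 y0 y2.
Proof. by rewrite /rect -!(cint_cat _ y0 y1 y2); ring. Qed.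

Lemma rectD E F x0 x1 y0 y1 : edge_cont E x0 x1 y0 y1 -> edge_cont F x0 x1 y0 y1 ->
  rect (fun z => E z + F z) x0 x1 y0 y1 = rect E x0 x1 y0 y1 + rect F x0 x1 y0 y1.
Proof.
move=> [a1 a2 a3 a4] [b1 b2 b3 b4]; rewrite /rect.
have -> : cint (hline (fun z => E z + F z) y0) x0 x1 = cint (hline E y0) x0 x1 + cint (hline F y0) x0 x1 by exact: cintD.
have -> : cint (hline (fun z => E z + F z) y1) x0 x1 = cint (hline E y1) x0 x1 + cint (hline F y1) x0 x1 by exact: cintD.
have -> : cint (vline (fun z => E z + F z) x0) y0 y1 = cint (vline E x0) y0 y1 + cint (vline F x0) y0 y1 by exact: cintD.
have -> : cint (vline (fun z => E z + F z) x1) y0 y1 = cint (vline E x1) y0 y1 + cint (vline F x1) y0 y1 by exact: cintD.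
ring.
Qed.

Lemma rectZ (c : C) E x0 x1 y0 y1 : edge_cont E x0 x1 y0 y1 ->
  rect (fun z => c * E z) x0 x1 y0 y1 = c * rect E x0 x1 y0 y1.
Proof.
move=> [a1 a2 a3 a4]; rewrite /rect.
have -> : cint (hline (fun z => c * E z) y0) x0 x1 = c * cint (hline E y0) x0 x1 by exact: cintZ.
have -> : cint (hline (fun z => c * E z) y1) x0 x1 = c * cint (hline E y1) x0 x1 by exact: cintZ.
have -> : cint (vline (fun z => c * E z) x0) y0 y1 = c * cint (vline E x0) y0 y1 by exact: cintZ.
have -> : cint (vline (fun z => c * E z) x1) y0 y1 = c * cint (vline E x1) y0 y1 by exact: cintZ.
ring.
Qed.

Lemma rect_bound E x0 x1 y0 y1 (M : R) : edge_cont E x0 x1 y0 y1 -> x0 <= x1 -> y0 <= y1 ->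
  (forall x y, x0 <= x <= x1 -> y0 <= y <= y1 ->
     [\/ x = x0, x = x1, y = y0 | y = y1] -> normc (E (x +i* y)) <= M) ->
  normc (rect E x0 x1 y0 y1) <= 4 * M * ((x1 - x0) + (y1 - y0)).
Proof.
move=> [a1 a2 a3 a4] x01 y01 HM; rewrite /rect.
have xx : x0 <= x0 <= x1 by rewrite lexx.
have xx' : x0 <= x1 <= x1 by rewrite lexx andbT.
have yy : y0 <= y0 <= y1 by rewrite lexx.
have yy' : y0 <= y1 <= y1 by rewrite lexx andbT.
have b1 : normc (cint (hline E y0) x0 x1) <= 2 * M * (x1 - x0).
  by apply: cint_bound => // t tI; rewrite /hline hpoint; apply: HM => //; exact: Or43.
have b2 : normc (cint (hline E y1) x0 x1) <= 2 * M * (x1 - x0).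
  by apply: cint_bound => // t tI; rewrite /hline hpoint; apply: HM => //; exact: Or44.
have b3 : normc (cint (vline E x0) y0 y1) <= 2 * M * (y1 - y0).
  by apply: cint_bound => // t tI; rewrite /vline vpoint; apply: HM => //; exact: Or41.
have b4 : normc (cint (vline E x1) y0 y1) <= 2 * M * (y1 - y0).
  by apply: cint_bound => // t tI; rewrite /vline vpoint; apply: HM => //; exact: Or42.
apply: le_trans (le_normcD _ _) _; rewrite normcM normc_imag normr1 mul1r.
have := le_normcD (cint (hline E y0) x0 x1) (- cint (hline E y1) x0 x1).
have := le_normcD (cint (vline E x1) y0 y1) (- cint (vline E x0) y0 y1).
rewrite !normcN; lra.
Qed.

Lemma rect_primitive E G x0 x1 y0 y1 : edge_cont E x0 x1 y0 y1 ->
  (forall z, cder G z (E z)) -> rect E x0 x1 y0 y1 = 0.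
Proof.
move=> [a1 a2 a3 a4] dG; rewrite /rect mulrBr.
have h y a b : rcont (hline E y) -> cint (hline E y) a b = G (b +i* y) - G (a +i* y).
  by move=> c; rewrite -[LHS]mul1r (cint_line a b c (fun t => dG _)) !hpoint.
have v x a b : rcont (vline E x) -> 'i * cint (vline E x) a b = G (x +i* b) - G (x +i* a).
  by move=> c; rewrite (cint_line a b c (fun t => dG _)) !vpoint.
by rewrite !h// !v//; ring.
Qed.

(** The intervals [[a n, a n + w / 2 ^+ n]] are nested, and the supremum of their left ends lies in
    all of them. *)
Lemma nested_point (a : nat -> R) (w : R) : 0 <= w ->
  (forall n, a n <= a n.+1 <= a n + w / 2 ^+ n.+1) ->
  exists X, forall n, a n <= X <= a n + w / 2 ^+ n.
Proof.
move=> w0 Ha.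
have half n : w / 2 ^+ n = w / 2 ^+ n.+1 + w / 2 ^+ n.+1.
  by rewrite exprS; field; rewrite expf_neq0.
have up n k : a n <= a (k + n)%N.
  by elim: k => [//|k IH]; rewrite addSn (le_trans IH)//; case/andP: (Ha (k + n)%N).
have dn n k : a (k + n)%N + w / 2 ^+ (k + n) <= a n + w / 2 ^+ n.
  elim: k => [//|k IH]; apply: le_trans IH; rewrite addSn (half (k + n)%N) addrA lerD2r.
  by case/andP: (Ha (k + n)%N).
have pos n : 0 <= w / 2 ^+ n by rewrite divr_ge0// exprn_ge0.
have ub n m : a m <= a n + w / 2 ^+ n.
  apply: le_trans (up m n) _; rewrite addnC; apply: le_trans (dn n m).
  by rewrite lerDl.
have hs : has_sup (range a).
  split; first by exists (a 0%N); exists 0%N.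
  by exists (a 0%N + w / 2 ^+ 0) => _ [m _ <-]; exact: ub.
exists (sup (range a)) => n; apply/andP; split.
  by apply: ub_le_sup; [case: hs|exists n].
by apply: ge_sup; [case: hs|move=> _ [m _ <-]; exact: ub].
Qed.

(** Bisection: some quarter of each rectangle carries at least a quarter of the integral. Near the
    limit point [E] is affine up to [e * normc h], and the affine part has a primitive, so the
    integral over the [n]-th rectangle is at most a multiple of [e / 4 ^+ n]. *)
Lemma goursat E x0 x1 y0 y1 : ccont E -> x0 <= x1 -> y0 <= y1 ->
  (forall x y, x0 <= x <= x1 -> y0 <= y <= y1 -> exists d, cder E (x +i* y) d) ->
  rect E x0 x1 y0 y1 = 0.
Proof.
move=> cE x01 y01 dE.
pose w := x1 - x0; pose v := y1 - y0.
have w0 : 0 <= w by rewrite subr_ge0. have v0 : 0 <= v by rewrite subr_ge0.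
have ew : x0 + w = x1 by rewrite /w addrC subrK.
have ev : y0 + v = y1 by rewrite /v addrC subrK.
have half (u : R) n : u / 2 ^+ n = u / 2 ^+ n.+1 + u / 2 ^+ n.+1.
  by rewrite exprS; field; rewrite expf_neq0.
(* The integral over the rectangle of generation [n] with lower left corner [p]. *)
pose Q n (p : R * R) := rect E p.1 (p.1 + w / 2 ^+ n) p.2 (p.2 + v / 2 ^+ n).
pose good n (p q : R * R) := [/\ p.1 <= q.1 <= p.1 + w / 2 ^+ n.+1,
  p.2 <= q.2 <= p.2 + v / 2 ^+ n.+1 & normc (Q n p) <= 4 * normc (Q n.+1 q)].
have pos (u : R) n : 0 <= u -> 0 <= u / 2 ^+ n by move=> u0; rewrite divr_ge0// exprn_ge0.
have step n p : exists q, good n p q.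
  pose a := w / 2 ^+ n.+1; pose b := v / 2 ^+ n.+1.
  have a0 : 0 <= a by exact: pos. have b0 : 0 <= b by exact: pos.
  have eQ : Q n p = (Q n.+1 p + Q n.+1 (p.1 + a, p.2)) + (Q n.+1 (p.1, p.2 + b) + Q n.+1 (p.1 + a, p.2 + b)).
    rewrite /Q /= !rect_hcat rect_vcat -!addrA -/a -/b.
    by rewrite [in LHS](half w) [in LHS](half v).
  apply: contrapT => /forallNP H.
  have lt q : p.1 <= q.1 <= p.1 + a -> p.2 <= q.2 <= p.2 + b -> 4 * normc (Q n.+1 q) < normc (Q n p).
    by move=> q1 q2; rewrite ltNge; apply/negP => q3; apply: (H q); split.
  have i1 : 4 * normc (Q n.+1 p) < normc (Q n p) by apply: lt; rewrite lexx lerDl.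
  have i2 : 4 * normc (Q n.+1 (p.1 + a, p.2)) < normc (Q n p).
    by apply: lt; rewrite !lexx lerDl ?a0 ?b0.
  have i3 : 4 * normc (Q n.+1 (p.1, p.2 + b)) < normc (Q n p).
    by apply: lt; rewrite !lexx lerDl ?a0 ?b0.
  have i4 : 4 * normc (Q n.+1 (p.1 + a, p.2 + b)) < normc (Q n p).
    by apply: lt; rewrite !lexx lerDl ?a0 ?b0.
  have := le_normcD (Q n.+1 p + Q n.+1 (p.1 + a, p.2)) (Q n.+1 (p.1, p.2 + b) + Q n.+1 (p.1 + a, p.2 + b)).
  have := le_normcD (Q n.+1 p) (Q n.+1 (p.1 + a, p.2)).
  have := le_normcD (Q n.+1 (p.1, p.2 + b)) (Q n.+1 (p.1 + a, p.2 + b)).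
  rewrite -eQ; lra.
have [nxt Hn] := choice (fun np : nat * (R * R) => step np.1 np.2).
pose s := fix s n := if n is n'.+1 then nxt (n', s n') else (x0, y0).
have Hs n : good n (s n) (s n.+1) by exact: (Hn (n, s n)).
have [|X HX] := @nested_point (fun n => (s n).1) w w0; first by move=> n; case: (Hs n).
have [|Y HY] := @nested_point (fun n => (s n).2) v v0; first by move=> n; case: (Hs n).
have Qs n : normc (rect E x0 x1 y0 y1) <= 4 ^+ n * normc (Q n (s n)).
  elim: n => [|n IH].
    by rewrite expr0 mul1r /Q expr0 !divr1 [(s 0%N).1]/= [(s 0%N).2]/= ew ev.
  apply: le_trans IH _; rewrite exprSr -mulrA ler_wpM2l ?exprn_ge0//.
  by case: (Hs n).
have XI : x0 <= X <= x1 by have := HX 0%N; rewrite expr0 divr1 ew.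
have YI : y0 <= Y <= y1 by have := HY 0%N; rewrite expr0 divr1 ev.
have [d /cderRP Hd] := dE X Y XI YI.
have S0 : 0 < w + v + 1 by lra.
suff small e : 0 < e -> normc (rect E x0 x1 y0 y1) <= 4 * e * (w + v + 1) ^+ 2.
  apply: eq0_normc; apply/eqP; rewrite eq_le normc_ge0 andbT.
  apply/ler_addgt0Pl => e e0; rewrite addr0.
  have := small (e / (4 * (w + v + 1) ^+ 2)).
  rewrite divr_gt0 ?mulr_gt0 ?exprn_gt0// => /(_ isT) /le_trans; apply.
  by rewrite le_eqVlt; apply/orP; left; apply/eqP; field; rewrite lt0r_neq0.
move=> e0; have [r r0 hr] := Hd e e0.
have [n hn] : exists n, (w + v + 1) / 2 ^+ n < r.
  exists (Num.bound ((w + v + 1) / r)).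
  rewrite ltr_pdivrMr ?exprn_gt0// mulrC -ltr_pdivrMr//.
  have := archi_boundP (ltW (divr_gt0 S0 r0)) => /lt_trans; apply.
  by rewrite -natrX ltr_nat ltn_expl.
set z0 := X +i* Y in hr.
(* The affine part of [E] at the limit point; it integrates to zero and can be subtracted. *)
pose A z := E z0 + d * (z - z0).
have pr z : cder (fun z => E z0 * z + d * 2^-1 * (z - z0) ^+ 2) z (A z).
  have -> : A z = (0 * z + E z0 * 1) + (0 * (z - z0) ^+ 2 + (d * 2^-1) * (2%:R * (z - z0) ^+ 1 * (1 - 0))).
    by rewrite /A; field.
  exact: (cderD (cderM (cder_cst _ _) (cder_id _))
    (cderM (cder_cst _ _) (cderX 1 (cderB (cder_id _) (cder_cst _ _))))).
have cA' : ccont A.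
  move=> z; apply: (@cder_ccont _ A z (0 + (0 * (z - z0) + d * (1 - 0)))).
  exact: (cderD (cder_cst _ _) (cderM (cder_cst _ _) (cderB (cder_id _) (cder_cst _ _)))).
have cA : ccont (fun z => - 1 * A z).
  move=> z; apply: (@cder_ccont _ (fun z => -1 * A z) z (0 * A z + -1 * (0 + (0 * (z - z0) + d * (1 - 0))))).
  exact: (cderM (cder_cst _ _) (cderD (cder_cst _ _)
    (cderM (cder_cst _ _) (cderB (cder_id _) (cder_cst _ _))))).
case: (s n) (HX n) (HY n) (Qs n) => a b /= /andP[aX Xa] /andP[bY Yb] HQ.
have wn := pos w n w0; have vn := pos v n v0.
have D0 : 0 < (2 : R) ^+ n by rewrite exprn_gt0.
have QE : Q n (a, b) = rect (fun z => E z + -1 * A z) a (a + w / 2 ^+ n) b (b + v / 2 ^+ n).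
  rewrite rectD; [|exact: ccont_edge|exact: ccont_edge].
  rewrite rectZ; last exact: ccont_edge.
  by rewrite (rect_primitive (ccont_edge _ _ _ _ cA') pr) mulr0 addr0.
have bd : normc (Q n (a, b)) <= 4 * (e * ((w + v + 1) / 2 ^+ n)) * ((w + v + 1) / 2 ^+ n).
  rewrite QE; apply: le_trans (rect_bound (M := e * ((w + v + 1) / 2 ^+ n)) _ _ _ _) _.
  - by apply: ccont_edge; exact: ccontD.
  - by rewrite lerDl.
  - by rewrite lerDl.
  - move=> x y /andP[ax xa] /andP[bY' yb] _.
    have := hr (x +i* y - z0); rewrite (addrC z0) subrK /A.
    have hh : normc (x +i* y - z0) <= (w + v + 1) / 2 ^+ n.
      apply: le_trans (normc_le_ReIm _) _; rewrite /z0 !raddfB /=.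
      have d1 : 0 < 1 / (2 : R) ^+ n by rewrite divr_gt0.
      rewrite !mulrDl.
      have h1 : `|x - X| <= w / 2 ^+ n by rewrite ler_norml; lra.
      have h2 : `|y - Y| <= v / 2 ^+ n by rewrite ler_norml; lra.
      move: h1 h2 d1; rewrite !mulrDl; move: (`|x - X|) (`|y - Y|) => p q; lra.
    move=> /(_ (le_lt_trans hh hn)) h3.
    have -> : E (x +i* y) + -1 * (E z0 + d * (x +i* y - z0)) = E (x +i* y) - E z0 - d * (x +i* y - z0) by ring.
    by apply: le_trans h3 _; rewrite ler_pM2l.
  - apply: ler_wpM2l; first by rewrite !mulr_ge0 ?divr_ge0// ltW.
    have d1 : 0 < 1 / (2 : R) ^+ n by rewrite divr_gt0.
    rewrite [leRHS]mulrDl [X in _ <= X + _]mulrDl; move: wn vn d1; lra.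
apply: le_trans HQ _; have -> : (4 : R) ^+ n = 2 ^+ n * 2 ^+ n by rewrite -exprMn; congr (_ ^+ _); ring.
apply: le_trans (ler_wpM2l _ bd) _; first by rewrite mulr_ge0// ltW.
rewrite le_eqVlt; apply/orP; left; apply/eqP; field; exact: lt0r_neq0.
Qed.
End Goursat.

(** * Cauchy's integral formula and the derivatives of entire functions *)

Section Cauchy.
Variable R : realType.
Local Notation C := R[i].
Implicit Types (E F G f g k : C -> C) (a d h w z : C).

Definition entire E := forall z, exists d, cder E z d.

Lemma entireD1 E z : entire E -> cder E z (cD E z).
Proof. by move=> /(_ z)[d dE]; rewrite (cderD1 dE). Qed.

Lemma entire_ccont E : entire E -> ccont E.
Proof. by move=> dE z; have [d /cder_ccont] := dE z. Qed.

Lemma eq_rect E F x0 x1 y0 y1 :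
  (forall x y, [\/ x = x0, x = x1, y = y0 | y = y1] -> E (x +i* y) = F (x +i* y)) ->
  rect E x0 x1 y0 y1 = rect F x0 x1 y0 y1.
Proof.
move=> H; rewrite /rect.
have -> : hline E y0 = hline F y0.
  by apply/funext => t; rewrite /hline hpoint; apply: H; exact: Or43.
have -> : hline E y1 = hline F y1.
  by apply/funext => t; rewrite /hline hpoint; apply: H; exact: Or44.
have -> : vline E x0 = vline F x0.
  by apply/funext => t; rewrite /vline vpoint; apply: H; exact: Or41.
have -> // : vline E x1 = vline F x1.
by apply/funext => t; rewrite /vline vpoint; apply: H; exact: Or42.
Qed.

(** The difference quotient, completed by [d] at [a], is continuous, and it is differentiable off
    [a]. The square splits into four rectangles that Goursat's theorem kills and a small square
    around [a], whose contribution tends to zero with its side. *)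
Lemma cauchy_quotient f a : entire f -> normc a < 1 ->
  rect (fun z => (f z - f a) * (z - a)^-1) (-1) 1 (-1) 1 = 0.
Proof.
move=> ef a1; pose d := cD f a; have fa : cder f a d by exact: entireD1.
pose g z := if z == a then d else (f z - f a) * (z - a)^-1.
have ga : - 1 < Re a < 1 by rewrite -ltr_norml (le_lt_trans (normc_Re a)).
have ia : - 1 < Im a < 1 by rewrite -ltr_norml (le_lt_trans (normc_Im a)).
rewrite (@eq_rect _ g); last first.
  move=> x y xy; rewrite /g; case: eqP => // eqa; exfalso.
  by move: ga ia; rewrite -eqa /=; case: xy => ->; rewrite ?ltxx ?andbF.
have dg z : z != a -> exists d, cder g z d.
  move=> za; have [d' dz] := ef z; eexists.
  apply: (cder_near (E := fun z => (f z - f a) * (z - a)^-1) (r := `|z - a|)).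
  - by rewrite normr_gt0 subr_eq0.
  - move=> w hw; rewrite /g; case: eqP => // wa.
    by move: hw; rewrite wa distrC ltxx.
  - apply: cderM; first by apply: cderB; [exact: dz|exact: cder_cst].
    apply: cderV; first by rewrite subr_eq0.
    by apply: cderB; [exact: cder_id|exact: cder_cst].
have ga0 e : 0 < e -> exists2 r : R, 0 < r & forall h, normc h < r -> normc (g (a + h) - d) <= e.
  move=> e0; have /cderRP/(_ e e0)[r r0 hr] := fa; exists r => // h /hr.
  rewrite /g; case: eqP => [ah|ah]; first by move=> _; rewrite subrr normc0 ltW.
  have h0 : h != 0 by apply/eqP => h0; apply: ah; rewrite h0 addr0.
  rewrite (_ : _ - _ - _ = ((f (a + h) - f a) * (a + h - a)^-1 - d) * h); last first.
    by rewrite (addrC a) addrK; field.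
  by rewrite normcM ler_pM2r// normc_gt0.
have gaE : g a = d by rewrite /g eqxx.
have cg : ccont g.
  move=> z; have [->|/dg[d' /cder_ccont]//] := eqVneq z a.
  by move=> e e0; have [r r0 hr] := ga0 e e0; exists r => // h /hr; rewrite gaE.
have [r r0 hr] := ga0 _ ltr01.
pose M := normc d + 1.
have M0 : 0 < M by rewrite ltr_wpDl// normc_ge0.
(* For [dl < mu] the square of half side [dl] around [a] lies inside the large one, and in the ball
   of radius [r] where [g] is bounded by [M]. *)
pose mu := Num.min (r / 2) (Num.min (Num.min (1 - Re a) (Re a + 1)) (Num.min (1 - Im a) (Im a + 1))).
have mu0 : 0 < mu by rewrite !lt_min divr_gt0//; lra.
suff small (dl : R) : 0 < dl < mu -> normc (rect g (-1) 1 (-1) 1) <= 16 * M * dl.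
  apply: eq0_normc; apply/eqP; rewrite eq_le normc_ge0 andbT.
  apply/ler_addgt0Pl => e e0; rewrite addr0.
  pose dl := Num.min (mu / 2) (e / (16 * M)).
  have M16 : 0 < 16 * M by rewrite mulr_gt0.
  have dlp : 0 < dl < mu.
    rewrite lt_min !divr_gt0//= /dl gt_min; apply/orP; left; lra.
  apply: le_trans (small _ dlp) _.
  by rewrite mulrC -ler_pdivlMr// ge_min lexx orbT.
move=> /andP[dl0]; rewrite !lt_min => /andP[dr /andP[/andP[d1 d2] /andP[d3 d4]]].
have off x0 x1 y0 y1 : x0 <= x1 -> y0 <= y1 ->
    [\/ x1 < Re a, Re a < x0, y1 < Im a | Im a < y0] -> rect g x0 x1 y0 y1 = 0.
  move=> x01 y01 H; apply: goursat => // x y /andP[xl xr] /andP[yl yr].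
  apply: dg; apply/eqP => xya; move: H; rewrite -xya /=; case; lra.
rewrite -(rect_hcat g (-1) (Re a - dl) 1) off ?add0r; [|lra|lra|by apply: Or41; lra].
rewrite -(rect_hcat g (Re a - dl) (Re a + dl) 1) (off (Re a + dl)) ?addr0; [|lra|lra|by apply: Or42; lra].
rewrite -(rect_vcat g _ _ (-1) (Im a - dl) 1) off ?add0r; [|lra|lra|by apply: Or43; lra].
rewrite -(rect_vcat g _ _ (Im a - dl) (Im a + dl) 1) (off _ _ (Im a + dl)) ?addr0; [|lra|lra|by apply: Or44; lra].
apply: le_trans (rect_bound (M := M) _ _ _ _) _; [exact: ccont_edge|lra|lra| |nra].
move=> x y /andP[xl xr] /andP[yl yr] _.
have hh : normc (x +i* y - a) < r.
  apply: le_lt_trans (normc_le_ReIm _) _; rewrite !raddfB/=.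
  have h1 : `|x - Re a| <= dl by rewrite ler_norml; lra.
  have h2 : `|y - Im a| <= dl by rewrite ler_norml; lra.
  lra.
have := hr _ hh; rewrite (addrC a) subrK => h1.
by rewrite -[g _](subrK d) addrC (le_trans (le_normcD _ _))// /M lerD2l.
Qed.

Lemma rcont_bounded (h : R -> C) (x y : R) : rcont h -> x <= y ->
  exists2 M : R, 0 <= M & forall t, x <= t <= y -> normc (h t) <= M.
Proof.
move=> [h1 h2] xy.
have c1 : {within `[x, y], continuous (fun t => `|Re (h t)|)}.
  by apply: continuous_subspaceT => t; apply: cvg_norm; exact: h1.
have c2 : {within `[x, y], continuous (fun t => `|Im (h t)|)}.
  by apply: continuous_subspaceT => t; apply: cvg_norm; exact: h2.
have [u _ hu] := EVT_max xy c1; have [v _ hv] := EVT_max xy c2.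
exists (`|Re (h u)| + `|Im (h v)|); first by rewrite addr_ge0.
move=> t tI; apply: le_trans (normc_le_ReIm _) _.
by rewrite lerD//; [apply: hu|apply: hv]; rewrite in_itv.
Qed.

(** The four full lines that carry the sides of the square, to match [edge_cont]. *)
Definition onsq z := [\/ Re z = -1, Re z = 1, Im z = -1 | Im z = 1].

Lemma onsq_normc z : onsq z -> 1 <= normc z.
Proof.
have := normc_Re z; have := normc_Im z; have := ler_norm (Re z); have := ler_norm (- Re z).
have := ler_norm (Im z); have := ler_norm (- Im z).
rewrite !normrN => ? ? ? ? ? ?; case; lra.
Qed.

Lemma onsq_far z a (e : R) : onsq z -> normc a < e -> 1 - e < normc (z - a).
Proof.
move=> /onsq_normc z1 ae; have := le_normcD (z - a) a; rewrite subrK; lra.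
Qed.

(** A Cauchy integral with kernel [k] over the square with vertices [±1 ± i]. The kernels used below
    are [w^-1], [w^-2] and [2 w^-3], each one the opposite of the derivative of the preceding
    one. *)
Definition csq f (k : C -> C) a := rect (fun z => f z * k (z - a)) (-1) 1 (-1) 1.

Lemma edge_sq E : (forall z, onsq z -> exists d, cder E z d) -> edge_cont E (-1) 1 (-1) 1.
Proof.
move=> H; split; apply: rcont_cder => t; apply: H; rewrite ?hpoint ?vpoint.
- exact: Or43. - exact: Or44. - exact: Or41. - exact: Or42.
Qed.

Lemma sq_bounded f : entire f -> exists2 M : R, 0 <= M &
  forall x y : R, -1 <= x <= 1 -> -1 <= y <= 1 ->
     [\/ x = -1, x = 1, y = -1 | y = 1] -> normc (f (x +i* y)) <= M.
Proof.
move=> /entire_ccont /(@ccont_edge _ _ (-1) 1 (-1) 1)[a1 a2 a3 a4].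
have I : -1 <= (1 : R) by lra.
have [M1 p1 h1] := rcont_bounded a1 I; have [M2 p2 h2] := rcont_bounded a2 I.
have [M3 p3 h3] := rcont_bounded a3 I; have [M4 p4 h4] := rcont_bounded a4 I.
exists (M1 + M2 + M3 + M4); first by rewrite !addr_ge0.
move=> x y xI yI [] e; rewrite e.
- have := h3 y yI; rewrite /vline vpoint; lra.
- have := h4 y yI; rewrite /vline vpoint; lra.
- have := h1 x xI; rewrite /hline hpoint; lra.
- have := h2 x xI; rewrite /hline hpoint; lra.
Qed.

(* Differentiation under the integral sign, where [k1] is [- k']. *)
Lemma cder_csq f (k k1 : C -> C) a (K : R) : entire f -> normc a < 4^-1 -> 0 <= K ->
  (forall w, 2^-1 < normc w -> exists d, cder k w d) ->
  (forall w, 2^-1 < normc w -> exists d, cder k1 w d) ->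
  (forall w h, 2^-1 < normc w -> 2^-1 < normc (w - h) ->
    normc (k (w - h) - k w - h * k1 w) <= K * normc h ^+ 2) ->
  cder (csq f k) a (csq f k1 a).
Proof.
move=> ef a4 K0 dk dk1 Hk; have [M M0 HM] := sq_bounded ef.
apply/cderRP => e e0.
have D0 : 0 < 8 * (M * K) + 1 by rewrite ltr_wpDl// !mulr_ge0.
(* The first bound keeps [a + h] in the disc of radius [1/2], so that on the square the kernels are
   evaluated at moduli above [1/2]; the second one absorbs the quadratic error. *)
exists (Num.min 4^-1 (e / (2 * (8 * (M * K) + 1)))).
  by rewrite lt_min invr_gt0 ltr0n divr_gt0// mulr_gt0.
move=> h; rewrite lt_min => /andP[h4 he].
have ah : normc (a + h) < 2^-1 by apply: le_lt_trans (le_normcD _ _) _; lra.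
have comp (kk : C -> C) a' : normc a' < 2^-1 -> (forall w, 2^-1 < normc w -> exists d, cder kk w d) ->
    edge_cont (fun z => f z * kk (z - a')) (-1) 1 (-1) 1.
  move=> ha' dkk; apply: edge_sq => z oz; have [d1 dz] := ef z.
  have [|d2 dz2] := dkk (z - a'); first by have := onsq_far oz ha'; lra.
  eexists; exact: (cderM dz (cder_comp (E := kk) (F := fun z => z - a') dz2
    (cderB (cder_id _) (cder_cst _ _)))).
have a2 : normc a < 2^-1 by lra.
have edN E c : edge_cont E (-1) 1 (-1) 1 -> edge_cont (fun z => c * E z) (-1) 1 (-1) 1.
  by case=> *; split; exact: rcontZ.
have edD E F : edge_cont E (-1) 1 (-1) 1 -> edge_cont F (-1) 1 (-1) 1 -> edge_cont (fun z => E z + F z) (-1) 1 (-1) 1.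
  by case=> ? ? ? ?; case=> *; split; exact: rcontD.
pose D z := f z * k (z - (a + h)) + (-1 * (f z * k (z - a)) + (- h) * (f z * k1 (z - a))).
have -> : csq f k (a + h) - csq f k a - csq f k1 a * h = rect D (-1) 1 (-1) 1.
  rewrite /csq rectD; [|exact: comp|by apply: (edD _ _); apply: (edN _ _); exact: comp].
  by rewrite rectD ?rectZ; [ring|exact: comp|exact: comp|apply: (edN _ _); exact: comp|apply: (edN _ _); exact: comp].
apply: le_trans (rect_bound (M := M * (K * normc h ^+ 2)) _ _ _ _) _.
- by apply: (edD _ _); [exact: comp|apply: (edD _ _); apply: (edN _ _); exact: comp].
- lra.
- lra.
- move=> x y xI yI xy; have oz : onsq (x +i* y) by exact: xy.
  rewrite /D; set z := x +i* y.
  have -> : f z * k (z - (a + h)) + (-1 * (f z * k (z - a)) + (- h) * (f z * k1 (z - a))) =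
     f z * (k (z - a - h) - k (z - a) - h * k1 (z - a)) by rewrite (_ : z - (a + h) = z - a - h); ring.
  rewrite normcM ler_pM ?normc_ge0//; first exact: HM.
  apply: Hk; first by have := onsq_far oz a4; rewrite -/z; lra.
  by rewrite -addrA -opprD; have := onsq_far oz ah; rewrite -/z; lra.
- have -> : 4 * (M * (K * normc h ^+ 2)) * (1 - -1 + (1 - -1)) = (2 * (8 * (M * K)) * normc h) * normc h by ring.
  rewrite ler_wpM2r ?normc_ge0//.
  move: he; rewrite ltr_pdivlMr ?mulr_gt0// => he.
  have := normc_ge0 h; nra.
Qed.

Lemma csq_inv_der f a : entire f -> normc a < 4^-1 ->
  cder (csq f (fun w => w^-1)) a (csq f (fun w => (w ^+ 2)^-1) a).
Proof.
(* The remainder is [h ^+ 2 * (w^-1 ^+ 2 * (w - h)^-1)], and both inverses have modulus at most [2]: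
   this gives the constant [8]. *)
have nz w : 2^-1 < normc w -> w != 0.
  by move=> h; rewrite -normc_gt0; lra.
move=> ef a4; apply: (cder_csq (K := 8)) => //.
- by move=> w /nz w0; eexists; apply: cderV => //; exact: cder_id.
- by move=> w /nz w0; eexists; apply: cderV; [exact: expf_neq0|apply: cderX; exact: cder_id].
- move=> w h hw hwh; have w0 := nz _ hw; have w1 := nz _ hwh.
  have -> : (w - h)^-1 - w^-1 - h * (w ^+ 2)^-1 = h ^+ 2 * (w^-1 ^+ 2 * (w - h)^-1) by field; rewrite w0 w1.
  rewrite normcM normcX normcM normcX !normcV mulrC ler_wpM2r ?exprn_ge0 ?normc_ge0//.
  have i1 : 0 <= (normc w)^-1 <= 2 by rewrite invr_ge0 normc_ge0 invf_ple ?posrE//; lra.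
  have i2 : 0 <= (normc (w - h))^-1 <= 2 by rewrite invr_ge0 normc_ge0 invf_ple ?posrE//; lra.
  move: i1 i2; move: (normc w)^-1 (normc (w - h))^-1 => p q /andP[p0 p2] /andP[q0 q2].
  have : p ^+ 2 <= 4 by nra.
  by have := sqr_ge0 p; nra.
Qed.

Lemma csq_inv2_der f a : entire f -> normc a < 4^-1 ->
  cder (csq f (fun w => (w ^+ 2)^-1)) a (csq f (fun w => 2 * (w ^+ 3)^-1) a).
Proof.
have nz w : 2^-1 < normc w -> w != 0.
  by move=> h; rewrite -normc_gt0; lra.
(* The two terms of the remainder are bounded by [4 * 4] and [2 * (8 * 2)] times [normc h ^+ 2]. *)
move=> ef a4; apply: (cder_csq (K := 48)) => //.
- by move=> w /nz w0; eexists; apply: cderV; [exact: expf_neq0|apply: cderX; exact: cder_id].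
- move=> w /nz w0; eexists; apply: cderM; first exact: cder_cst.
  by apply: cderV; [exact: expf_neq0|apply: cderX; exact: cder_id].
- move=> w h hw hwh; have w0 := nz _ hw; have w1 := nz _ hwh.
  have -> : ((w - h) ^+ 2)^-1 - (w ^+ 2)^-1 - h * (2 * (w ^+ 3)^-1) =
     h ^+ 2 * (w^-1 ^+ 2 * (w - h)^-1 ^+ 2 + 2 * w^-1 ^+ 3 * (w - h)^-1) by field; rewrite w0 w1.
  rewrite normcM normcX mulrC ler_wpM2r ?exprn_ge0 ?normc_ge0//.
  apply: le_trans (le_normcD _ _) _.
  have n2 : normc (2 : C) = 2 by have := normc_real (2 : R); rewrite rmorph_nat ger0_norm.
  rewrite normcM !normcX normcM normcM normcX !normcV n2.
  have i1 : 0 <= (normc w)^-1 <= 2 by rewrite invr_ge0 normc_ge0 invf_ple ?posrE//; lra.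
  have i2 : 0 <= (normc (w - h))^-1 <= 2 by rewrite invr_ge0 normc_ge0 invf_ple ?posrE//; lra.
  move: i1 i2; move: (normc w)^-1 (normc (w - h))^-1 => p q /andP[p0 p2] /andP[q0 q2].
  have e1 : 0 <= p ^+ 2 <= 4 by rewrite sqr_ge0; nra.
  have e2 : 0 <= q ^+ 2 <= 4 by rewrite sqr_ge0; nra.
  have e3 : 0 <= p ^+ 3 <= 8 by rewrite exprn_ge0//= exprS; nra.
  have f1 : p ^+ 2 * q ^+ 2 <= 4 * 4 by apply: ler_pM; lra.
  have f2 : p ^+ 3 * q <= 8 * 2 by apply: ler_pM; lra.
  lra.
Qed.

Lemma Im_rect E x0 x1 y0 y1 : Im (rect E x0 x1 y0 y1) =
  rint (fun t => Im (hline E y0 t)) x0 x1 - rint (fun t => Im (hline E y1 t)) x0 x1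
  + (rint (fun t => Re (vline E x1 t)) y0 y1 - rint (fun t => Re (vline E x0 t)) y0 y1).
Proof.
rewrite /rect /cint; do 2![move: (rint (fun t => Re (hline _ _ t)) _ _) (rint (fun t => Im (hline _ _ t)) _ _) => ? ?].
do 2![move: (rint (fun t => Re (vline _ _ t)) _ _) (rint (fun t => Im (vline _ _ t)) _ _) => ? ?].
by simpc.
Qed.

(** All four sides contribute a positive amount to the imaginary part; the mean value theorem
    replaces each side by one point, where the sign is visible. *)
Lemma csq1_neq0 : csq (fun=> 1) (fun w => w^-1) 0 != 0.
Proof.
apply/eqP => H.
have : Im (csq (fun=> 1) (fun w => w^-1) 0) = 0 by rewrite H.
have ce : edge_cont (fun z : C => 1 * (z - 0)^-1) (-1) 1 (-1) 1.
  apply: edge_sq => z /onsq_normc z1; eexists; apply: cderM; first exact: cder_cst.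
  apply: cderV; first by rewrite subr0 -normc_gt0; lra.
  by apply: cderB; [exact: cder_id|exact: cder_cst].
case: ce; rewrite /rcont => -[_ c1] [_ c2] [c3 _] [c4 _].
have ab : -1 < (1 : R) by lra.
have [u1 _ e1] := rint_mvt c1 ab; have [u2 _ e2] := rint_mvt c2 ab.
have [u3 _ e3] := rint_mvt c3 ab; have [u4 _ e4] := rint_mvt c4 ab.
rewrite Im_rect e1 e2 e3 e4 /hline /vline !hpoint !vpoint !mul1r !subr0 /=.
have p (x y : R) : y ^+ 2 = 1 -> 0 < (x ^+ 2 + y ^+ 2)^-1.
  by move=> ->; rewrite invr_gt0 ltr_wpDl// sqr_ge0.
have q (x y : R) : y ^+ 2 = 1 -> 0 < (y ^+ 2 + x ^+ 2)^-1.
  by move=> ->; rewrite invr_gt0 ltr_wpDr// sqr_ge0.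
have N1 : (-1 : R) ^+ 2 = 1 by rewrite sqrrN expr1n.
have := p u1 _ N1; have := p u2 _ (expr1n _ 2); have := q u3 _ N1; have := q u4 _ (expr1n _ 2).
lra.
Qed.

(* [csq 1 (/ w) a] is [2 i pi], but it only matters that it is not zero at [0] and differentiable. *)
Lemma cauchy_formula f a : entire f -> normc a < 4^-1 ->
  f a * csq (fun=> 1) (fun w => w^-1) a = csq f (fun w => w^-1) a.
Proof.
move=> ef a4; have a1 : normc a < 1 by lra.
have ce g : entire g -> edge_cont (fun z : C => g z * (z - a)^-1) (-1) 1 (-1) 1.
  move=> eg; apply: edge_sq => z oz; have [d dz] := eg z.
  have := onsq_far oz a4 => za; eexists; apply: cderM; first exact: dz.
  apply: cderV; first by rewrite -normc_gt0; lra.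
  by apply: cderB; [exact: cder_id|exact: cder_cst].
have e1 : entire (fun=> 1 : C) by move=> z; exists 0; exact: cder_cst.
have ceN : edge_cont (fun z : C => - f a * (1 * (z - a)^-1)) (-1) 1 (-1) 1.
  by case: (ce _ e1) => *; split; exact: rcontZ.
have := cauchy_quotient ef a1.
rewrite (_ : (fun z => (f z - f a) * (z - a)^-1) = (fun z => f z * (z - a)^-1 + - f a * (1 * (z - a)^-1))); last first.
  by apply/funext => z; ring.
rewrite rectD; [|exact: ce|exact: ceN].
rewrite rectZ; last exact: (ce _ e1).
by rewrite mulNr => /eqP; rewrite subr_eq0 => /eqP h; exact: esym h.
Qed.

(** By Cauchy's formula [f] is the quotient [N / W] of two integrals near [0]. Both are twice
    differentiable in the parameter and [W] does not vanish there, hence [f] is twice differentiable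
    at [0]. *)
Lemma entire_cD0 f : entire f -> exists d, cder (cD f) 0 d.
Proof.
move=> ef; have e1 : entire (fun=> 1 : C) by move=> z; exists 0; exact: cder_cst.
pose W := csq (fun=> 1) (fun w : C => w^-1).
pose W1 := csq (fun=> 1) (fun w : C => (w ^+ 2)^-1).
pose N := csq f (fun w : C => w^-1).
pose N1 := csq f (fun w : C => (w ^+ 2)^-1).
have i4 : 0 < (4^-1 : R) by rewrite invr_gt0.
have z4 : normc (0 : C) < 4^-1 by rewrite normc0.
have dW a : normc a < 4^-1 -> cder W a (W1 a) by exact: csq_inv_der.
have dN a : normc a < 4^-1 -> cder N a (N1 a) by exact: csq_inv_der.
have W0 : W 0 != 0 by exact: csq1_neq0.
have [r r0 hr] : exists2 r : R, 0 < r & forall a, normc a < r -> normc a < 4^-1 /\ W a != 0.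
  have w2 : 0 < normc (W 0) / 2 by rewrite divr_gt0// normc_gt0.
  have [r r0 hr] := cder_ccont (dW 0 z4) w2.
  exists (Num.min r 4^-1); first by rewrite lt_min r0.
  move=> a; rewrite lt_min => /andP[/hr]; rewrite add0r => h ->; split => //.
  apply/eqP => Wa; move: h; rewrite Wa sub0r normcN; lra.
have rC : 0 < r%:C by rewrite ltcR.
have df a : normc a < r -> cD f a = N1 a * (W a)^-1 + N a * - (W1 a / W a ^+ 2).
  move=> /[dup] ar /hr[a4 Wa]; apply: cderD1.
  have ra : 0 < r - normc a by rewrite subr_gt0.
  apply: (cder_near (E := fun z => N z * (W z)^-1) (r := (r - normc a)%:C)).
  - by rewrite ltcR.
  - move=> w; rewrite normcE0 ltcR => hw.
    have /hr[w4 Ww] : normc w < r by have := le_normcD (w - a) a; rewrite subrK; lra.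
    by rewrite /N -cauchy_formula// mulfK.
  - exact: (cderM (dN _ a4) (cderV Wa (dW _ a4))).
have dW1 : cder W1 0 (csq (fun=> 1) (fun w => 2 * (w ^+ 3)^-1) 0) by exact: csq_inv2_der.
have dN1 : cder N1 0 (csq f (fun w => 2 * (w ^+ 3)^-1) 0) by exact: csq_inv2_der.
have W20 : W 0 ^+ 2 != 0 by rewrite expf_neq0.
have dE := cderD (cderM dN1 (cderV W0 (dW _ z4)))
  (cderM (dN _ z4) (cderN (cderM dW1 (cderV (E := fun a => W a ^+ 2) W20 (cderX 1 (dW _ z4)))))).
eexists; apply: cder_near dE; first exact: rC.
by move=> w; rewrite subr0 normcE0 ltcR => /df ->.
Qed.

Lemma entire_cD f : entire f -> entire (cD f).
Proof.
move=> ef c; pose g z := f (z + c).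
have dg z : cder g z (cD f (z + c)).
  have -> : cD f (z + c) = cD f (z + c) * (1 + 0) by rewrite addr0 mulr1.
  exact: (cder_comp (F := fun z => z + c) (entireD1 (z + c) ef) (cderD (cder_id _) (cder_cst _ _))).
have eg : entire g by move=> z; eexists; exact: dg.
have [d] := entire_cD0 eg.
have -> : cD g = fun z => cD f (z + c) by apply/funext => z; exact: cderD1 (dg z).
move=> h; exists (d * (1 - 0)).
apply: (cder_ext (E := fun w => cD f (w - c + c))) => [w|]; first by rewrite subrK.
apply: (cder_comp (E := fun z => cD f (z + c)) (F := fun w => w - c)).
  by rewrite subrr.
exact: (cderB (cder_id _) (cder_cst _ _)).
Qed.
End Cauchy.

(** * A theorem of Picard type *)

Section SecondDerivative.
Variable R : realType.
Implicit Types (f g Phi DPhi : R -> R) (a b x t : R).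

(* [f] is differentiable near [0], with [f' 0 = a] and [f'' 0 = b]. *)
Definition d2 f a b := exists2 f1, (exists2 r : R, 0 < r & forall t, `|t| < r -> cder f t (f1 t)) &
  f1 0 = a /\ cder f1 0 b.

Lemma d2D f g a b a' b' : d2 f a b -> d2 g a' b' -> d2 (fun t => f t + g t) (a + a') (b + b').
Proof.
move=> [f1 [r r0 hr] [<- d1]] [g1 [s s0 hs] [<- d1']].
exists (fun t => f1 t + g1 t); last by split => //; exact: cderD.
exists (Num.min r s); first by rewrite lt_min r0.
by move=> t; rewrite lt_min => /andP[/hr ? /hs ?]; exact: cderD.
Qed.

Lemma d2Z (c : R) f a b : d2 f a b -> d2 (fun t => c * f t) (c * a) (c * b).
Proof.
move=> [f1 [r r0 hr] [<- d1]].
have h F t d : cder F t d -> cder (fun t => c * F t) t (c * d).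
  by move=> hF; have := cderM (cder_cst c t) hF; rewrite mul0r add0r.
exists (fun t => c * f1 t); last by split => //; exact: h.
by exists r => // t /hr; exact: h.
Qed.

(** [S] is a domain on which [Phi] is differentiable, such as the positive numbers for [ln], and
    which [f] does not leave near [0]. *)
Lemma d2_comp (S : R -> Prop) Phi DPhi (c : R) f a b :
  (forall x, S x -> cder Phi x (DPhi x)) -> cder DPhi (f 0) c ->
  (exists2 r : R, 0 < r & forall t, `|t| < r -> S (f t)) ->
  d2 f a b -> d2 (fun t => Phi (f t)) (DPhi (f 0) * a) (c * a ^+ 2 + DPhi (f 0) * b).
Proof.
move=> dPhi dDPhi [s s0 hs] [f1 [r r0 hr] [<- d1]].
exists (fun t => DPhi (f t) * f1 t).
  exists (Num.min r s); first by rewrite lt_min r0.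
  by move=> t; rewrite lt_min => /andP[/hr ? /hs ?]; apply: cder_comp => //; exact: dPhi.
split => //; have df0 : cder f 0 (f1 0) by apply: hr; rewrite normr0.
by have := cderM (cder_comp dDPhi df0) d1; rewrite -mulrA -expr2.
Qed.

(** A nonzero slope [a] is excluded first. Then [b > 0] would make [f1] positive just to the right
    of [0], and the mean value theorem would produce a value above [f 0]. *)
Lemma d2_max f a b (r : R) : d2 f a b -> 0 < r -> (forall t, `|t| < r -> f t <= f 0) -> b <= 0.
Proof.
move=> [f1 [s s0 hs] [fa d1]] r0 Hmax.
have d0 : cder f 0 a by rewrite -fa; apply: hs; rewrite normr0.
have a0 : a = 0.
  apply/eqP/negP => /negP an0; have a2 : 0 < `|a| / 2 by rewrite divr_gt0// normr_gt0.
  have /cderP /(_ _ a2)[u u0 hu] := d0.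
  pose m := Num.min r u / 2; have m0 : 0 < m by rewrite divr_gt0// lt_min r0.
  have mr : m < r by rewrite /m; have := ge_min r r u; rewrite lexx /= => ?; lra.
  have mu : m < u by rewrite /m; have := ge_min u r u; rewrite lexx orbT => ?; lra.
  have [ap|an] : 0 < a \/ a < 0 by have := lt_total an0; case/orP; [right|left].
  - have := hu m; have := Hmax m; rewrite add0r (gtr0_norm m0) (gtr0_norm ap) => /(_ mr) h1 /(_ mu).
    by rewrite ler_norml => /andP[h2 _]; nra.
  - have := hu (- m); have := Hmax (- m); rewrite add0r !normrN (gtr0_norm m0) (ltr0_norm an) => /(_ mr) h1 /(_ mu).
    by rewrite ler_norml => /andP[h2 _]; nra.
rewrite leNgt; apply/negP => b0; have b2 : 0 < b / 2 by rewrite divr_gt0.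
have /cderP /(_ _ b2)[u u0 hu] := d1.
pose m := Num.min (Num.min r s) u / 2; have m0 : 0 < m by rewrite divr_gt0// !lt_min r0 s0.
have M1 : 0 < Num.min (Num.min r s) u by rewrite !lt_min r0 s0.
have [mr ms mu] : [/\ m < r, m < s & m < u].
  have h : m < Num.min (Num.min r s) u by rewrite /m ltr_pdivrMr// ltr_pMr// ltr1n.
  by move: h; rewrite !lt_min => /andP[/andP[]].
have D x : x \in `[0, m] -> is_derive x 1 f (f1 x).
  rewrite in_itv/= => /andP[x0 xm]; apply: hs; rewrite ger0_norm//; exact: le_lt_trans ms.
have Cn : {within `[0, m], continuous f}.
  by apply: derivable_within_continuous => x /D[].
have [c cI] := MVT m0 (fun x xI => D x (subset_itv_oo_cc xI)) Cn.
move: cI; rewrite in_itv/= subr0 => /andP[c0 cm] eq.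
have cu : c < u by exact: lt_trans mu.
have := hu c; have := Hmax m; rewrite add0r fa a0 subr0 (gtr0_norm m0) (gtr0_norm c0) => /(_ mr) h1 /(_ cu).
rewrite ler_norml => /andP[h2 _]; have bc : 0 < b * c by rewrite mulr_gt0.
have f1c : 0 < f1 c by lra.
have := mulr_gt0 f1c m0; lra.
Qed.

Lemma cder_pos_near f (z d : R) : cder f z d -> 0 < f z ->
  exists2 r : R, 0 < r & forall t, `|t| < r -> 0 < f (z + t).
Proof.
move=> /cder_lipschitz[s s0 hs] f0.
have D0 : 0 < 1 + `|d| by rewrite ltr_pwDl.
exists (Num.min s (f z / (2 * (1 + `|d|)))); first by rewrite lt_min s0 divr_gt0// mulr_gt0.
move=> t; rewrite lt_min => /andP[ts]; rewrite ltr_pdivlMr ?mulr_gt0// => h.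
have := hs t ts; rewrite ler_norml => /andP[h1 _].
by move: h h1; rewrite mulrCA (mulrC `|t|); lra.
Qed.

Lemma d2_ln f a b : 0 < f 0 -> d2 f a b ->
  d2 (fun t => ln (f t)) (a / f 0) (b / f 0 - (a / f 0) ^+ 2).
Proof.
move=> f0 df; case: (df) => f1 [r r0 hr] [fa d1].
have dfa : cder f 0 (f1 0) by apply: hr; rewrite normr0.
have dinv : cder (fun x : R => x^-1) (f 0) (- (1 / f 0 ^+ 2)).
  by apply: (cderV (E := id)); [exact: lt0r_neq0|exact: cder_id].
have pos : exists2 r : R, 0 < r & forall t, `|t| < r -> 0 < f t.
  by have [s s0 hs] := cder_pos_near dfa f0; exists s => // t /hs; rewrite add0r.
have := d2_comp (S := fun x => 0 < x) (Phi := @ln R) (DPhi := fun x => x^-1)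
   (fun x p => @is_derive1_ln R x p) dinv pos df.
rewrite (mulrC _ a) (mulrC _ b) addrC exprMn exprVn mulNr div1r.
by rewrite (mulrC _ (a ^+ 2)).
Qed.

(** For [f = ln (nsq E)] the exponential is the fourth root of the modulus of [E]. The positive term
    in [a ^+ 2], due to convexity, is the source of the negative curvature. *)
Lemma d2_softplus f a b (e := expR (8^-1 * f 0)) : d2 f a b ->
  d2 (fun t => ln (1 + expR (8^-1 * f t))) (8^-1 * e / (1 + e) * a)
     (64^-1 * e / (1 + e) ^+ 2 * a ^+ 2 + 8^-1 * e / (1 + e) * b).
Proof.
move=> df; pose g x := expR (8^-1 * x).
have g0 x : 0 < g x by exact: expR_gt0.
have dg x : cder g x (8^-1 * g x).
  have h : cder (fun x : R => 8^-1 * x) x (8^-1).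
    by have := cderM (cder_cst (8^-1 : R) x) (cder_id x); rewrite mul0r add0r mulr1.
  by have := cder_comp (E := @expR R) (F := fun x : R => 8^-1 * x) (is_derive_expR (8^-1 * x)) h; rewrite mulrC.
have g1 x : 0 < 1 + g x by rewrite addr_gt0.
have d1g x : cder (fun x => 1 + g x) x (8^-1 * g x).
  by have := cderD (cder_cst (1 : R) x) (dg x); rewrite add0r.
apply: (d2_comp (S := fun=> True) (Phi := fun x => ln (1 + g x)) (DPhi := fun x => 8^-1 * g x / (1 + g x))).
- move=> x _; have := cder_comp (E := @ln R) (F := fun x => 1 + g x) (@is_derive1_ln R _ (g1 x)) (d1g x).
  by rewrite mulrC.
- have nz : 1 + g (f 0) != 0 by exact: lt0r_neq0.
  have := cderM (cderM (cder_cst (8^-1 : R) (f 0)) (dg (f 0))) (cderV (E := fun x => 1 + g x) nz (d1g (f 0))).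
  rewrite /e -/(g (f 0)); congr cder; move: (g (f 0)) nz => y nz; field; exact: nz.
- by exists 1.
- exact: df.
Qed.
End SecondDerivative.

Section Picard.
Variable R : realType.
Local Notation C := R[i].
Implicit Types (E F : C -> C) (z th : C).

Definition nsq z : R := Re z ^+ 2 + Im z ^+ 2.

Lemma nsqE z : nsq z = normc z ^+ 2.
Proof. by rewrite normc_sqr. Qed.

Lemma nsq_gt0 z : z != 0 -> 0 < nsq z.
Proof. by move=> z0; rewrite nsqE exprn_gt0// normc_gt0. Qed.

Lemma Re_div (w z : C) : Re (w / z) = (Re w * Re z + Im w * Im z) / nsq z.
Proof. by case: w => a b; case: z => c d; rewrite /nsq /=; ring. Qed.

Lemma line0 (z th : C) : z + (0 : R)%:C * th = z.
Proof. by rewrite rmorph0 mul0r addr0. Qed.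

Lemma near_line_neq0 F z th : entire F -> F z != 0 ->
  exists2 r : R, 0 < r & forall t : R, `|t| < r -> F (z + t%:C * th) != 0.
Proof.
move=> eF Fz.
have n2 : 0 < normc (F z) / 2 by rewrite divr_gt0// normc_gt0.
have [r r0 hr] := cder_ccont (entireD1 z eF) n2.
have T0 : 0 < normc th + 1 by rewrite ltr_wpDl// normc_ge0.
exists (r / (normc th + 1)); first exact: divr_gt0.
move=> t; rewrite ltr_pdivlMr// => ht; apply/eqP => F0.
have /hr : normc (t%:C * th) < r.
  by rewrite normcM normc_real; apply: le_lt_trans ht; rewrite ler_wpM2l// lerDl.
rewrite F0 sub0r normcN; have : 0 < normc (F z) by rewrite normc_gt0. lra.
Qed.

(** The direction enters the second derivative through [th ^+ 2] only, so the directions [1] and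
    ['i] give opposite values: [ln (nsq F)] is harmonic where [F] does not vanish. *)
Lemma d2_logn F z th : entire F -> F z != 0 ->
  d2 (fun t : R => ln (nsq (F (z + t%:C * th)))) (2 * Re (th * (cD F z / F z)))
   (2 * Re (th ^+ 2 * ((cD (cD F) z * F z - cD F z ^+ 2) / F z ^+ 2))).
Proof.
move=> eF Fz.
pose G w := (2%:R * th) * (cD F w * (F w)^-1).
have [r r0 hr] := near_line_neq0 th eF Fz.
have Re2 (w : C) : Re (2%:R * w) = 2 * Re w by rewrite mulr_natl raddfMn /= mulr_natl.
exists (fun t => Re (G (z + t%:C * th))); last split.
- exists r => // t /hr; set w := z + t%:C * th => Fw.
  have dF := entireD1 w eF.
  have h1 := cderX 1 (cderRe dF); have h2 := cderX 1 (cderIm dF).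
  have h := cder_comp (E := @ln R) (F := fun t : R => nsq (F (z + t%:C * th))) (@is_derive1_ln R _ (nsq_gt0 Fw)) (cderD h1 h2).
  rewrite /G -!mulrA Re2 mulrA Re_div (mulrC th).
  rewrite (_ : 2 * _ = (nsq (F w))^-1 * (2 * Re (F w) ^+ 1 * Re (cD F w * th) +
    2 * Im (F w) ^+ 1 * Im (cD F w * th))) //; rewrite !expr1; ring.
- by rewrite line0 /G -!mulrA Re2.
- rewrite (_ : 2 * Re _ = Re (((2%:R * th) * (cD (cD F) z * (F z)^-1 + cD F z * - (cD F z / F z ^+ 2))) * th)); last first.
    rewrite -Re2; congr (Re _); move: (cD (cD F) z) (cD F z) (F z) Fz => p q s s0; field; exact: s0.
  apply: cderRe; rewrite line0.
  have := cderM (cder_cst (2%:R * th) z) (cderM (entireD1 z (entire_cD eF)) (cderV Fz (entireD1 z eF))).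
  by rewrite mul0r add0r.
Qed.

Lemma d2_disc (r : R) z th : nsq th = 1 -> 0 < r ^+ 2 - nsq z ->
  d2 (fun t : R => ln (r ^+ 2 - nsq (z + t%:C * th)))
     (- (2 * (Re z * Re th + Im z * Im th)) / (r ^+ 2 - nsq z))
     (- 2 / (r ^+ 2 - nsq z) - (- (2 * (Re z * Re th + Im z * Im th)) / (r ^+ 2 - nsq z)) ^+ 2).
Proof.
move=> th1 g0.
pose s := Re z * Re th + Im z * Im th.
have e t : r ^+ 2 - nsq (z + t%:C * th) = (r ^+ 2 - nsq z) + (- (2 * s)) * t + (- 1) * t ^+ 2.
  have -> : -1 * t ^+ 2 = - nsq th * t ^+ 2 by rewrite th1.
  rewrite /s /nsq; case: (z) => a b; case: (th) => c d /=; ring.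
have h : d2 (fun t : R => r ^+ 2 - nsq (z + t%:C * th)) (- (2 * s)) (- 2).
  rewrite (funext e); exists (fun t => - (2 * s) + (- 2) * t).
    exists 1 => // t _.
    rewrite (_ : - (2 * s) + -2 * t = 0 + (0 * t + (- (2 * s)) * 1) + (0 * t ^+ 2 + -1 * (2%:R * t ^+ 1 * 1))); last by ring.
    exact: (cderD (cderD (cder_cst _ _) (cderM (cder_cst _ _) (cder_id _)))
      (cderM (cder_cst _ _) (cderX 1 (cder_id _)))).
  split; first by rewrite mulr0 addr0.
  rewrite [X in cder _ _ X](_ : _ = 0 + (0 * 0 + (-2) * 1)); last by ring.
  exact: (cderD (cder_cst _ _) (cderM (cder_cst _ _) (cder_id _))).
have g0' : 0 < r ^+ 2 - nsq (z + (0 : R)%:C * th) by rewrite line0.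
by have := d2_ln g0' h; rewrite line0.
Qed.
End Picard.

(** * The metric of negative curvature and its bound on discs *)

Section PicardTheorem.
Variable R : realType.
Local Notation C := R[i].
Implicit Types (E F : C -> C) (z th : C).

(* The conclusion bounds the square of the density of the metric, the hypothesis on [S] comes from
   the Laplacian of its logarithm. *)
Lemma metric_bound (M P Q S : R) : 0 < P -> 0 < Q -> 0 <= M -> 1 <= P ^+ 4 + Q ^+ 4 ->
  M / (P ^+ 7 * (1 + P) ^+ 2) + M / (Q ^+ 7 * (1 + Q) ^+ 2) <= S ->
  M / Q ^+ 7 * (1 + P) * (1 + Q) / P ^+ 7 <= 648 * S.
Proof.
(* The claim is symmetric, so [Q <= P] may be assumed; then [P >= 1/2], and [1 + P] and [1 + Q] are
   at most [3 * P]. *)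
move: P Q; suff W (P Q : R) : 0 < P -> 0 < Q -> 0 <= M -> 1 <= P ^+ 4 + Q ^+ 4 -> Q <= P ->
    M / (P ^+ 7 * (1 + P) ^+ 2) + M / (Q ^+ 7 * (1 + Q) ^+ 2) <= S ->
    M / Q ^+ 7 * (1 + P) * (1 + Q) / P ^+ 7 <= 648 * S.
  move=> P Q P0 Q0 M0 PQ h; have [QP|/ltW QP] := leP Q P; first exact: W.
  have -> : M / Q ^+ 7 * (1 + P) * (1 + Q) / P ^+ 7 = M / P ^+ 7 * (1 + Q) * (1 + P) / Q ^+ 7.
    by field; rewrite !lt0r_neq0.
  by apply: W => //; rewrite addrC.
move=> P0 Q0 M0 PQ QP h.
have T1 : 0 <= M / (P ^+ 7 * (1 + P) ^+ 2) by rewrite divr_ge0// mulr_ge0 ?exprn_ge0//; lra.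
have T2 : 0 <= M / (Q ^+ 7 * (1 + Q) ^+ 2) by rewrite divr_ge0// mulr_ge0 ?exprn_ge0//; lra.
have PQ4 : Q ^+ 4 <= P ^+ 4 by rewrite lerXn2r// nnegrE ltW.
have P2 : 2^-1 <= P.
  rewrite leNgt; apply/negP => P2.
  have : P ^+ 4 <= 2^-1 ^+ 4 by rewrite lerXn2r// ?nnegrE ?ltW// invr_gt0.
  have -> : (2^-1 : R) ^+ 4 = 16^-1 by rewrite exprVn -natrX.
  lra.
have -> : M / Q ^+ 7 * (1 + P) * (1 + Q) / P ^+ 7 =
    M / (Q ^+ 7 * (1 + Q) ^+ 2) * ((1 + P) * (1 + Q) ^+ 3 / P ^+ 7).
  by field; rewrite !lt0r_neq0//; lra.
(* [648 = 81 * 8]: the quotient is at most [81 / P ^+ 3], and [P >= 1/2]. *)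
rewrite (mulrC 648); apply: ler_pM => //; last 1 first.
- rewrite ler_pdivrMr ?exprn_gt0//.
  have h3 : (1 + Q) ^+ 3 <= (3 * P) ^+ 3 by rewrite lerXn2r// ?nnegrE; lra.
  have h4 : (1 + P) * (1 + Q) ^+ 3 <= (3 * P) * (3 * P) ^+ 3.
    by apply: ler_pM => //; rewrite ?exprn_ge0//; lra.
  apply: le_trans h4 _.
  have -> : 3 * P * (3 * P) ^+ 3 = 81 * P ^+ 4 by ring.
  have -> : 648 * P ^+ 7 = (648 * P ^+ 3) * P ^+ 4 by ring.
  apply: ler_wpM2r; first by rewrite exprn_ge0// ltW.
  have : 2^-1 ^+ 3 <= P ^+ 3 by rewrite lerXn2r// ?nnegrE ?invr_ge0// ltW.
  have -> : (2^-1 : R) ^+ 3 = 8^-1 by rewrite exprVn -natrX.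
  lra.
- by rewrite divr_ge0 ?mulr_ge0 ?exprn_ge0//; lra.
- lra.
Qed.

Lemma continuous_plane (f : C -> R) : (forall z (e : R), 0 < e -> exists2 r : R, 0 < r &
    forall h, normc h < r -> `|f (z + h) - f z| <= e) ->
  continuous (fun p : R * R => f (p.1 +i* p.2)).
Proof.
move=> H p; apply/cvgrPdist_le => e e0; have [r r0 hr] := H (p.1 +i* p.2) e e0.
have r2 : 0 < r / 2 by rewrite divr_gt0.
near=> q; rewrite distrC.
have -> : q.1 +i* q.2 = (p.1 +i* p.2) + ((q.1 - p.1) +i* (q.2 - p.2)).
  by simpc; rewrite !(addrC _ (_ - _)) !subrK.
apply: hr; apply: le_lt_trans (normc_le_ReIm _) _ => /=.
have h1 : `|q.1 - p.1| < r / 2.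
  rewrite distrC; near: q; apply: (@cvgr_dist_lt _ _ _ _ _ (fst : R * R -> R) p.1) => //; exact: cvg_fst.
have h2 : `|q.2 - p.2| < r / 2.
  rewrite distrC; near: q; apply: (@cvgr_dist_lt _ _ _ _ _ (snd : R * R -> R) p.2) => //; exact: cvg_snd.
lra.
Unshelve. all: by end_near. Qed.

Lemma continuous_normc E : ccont E -> continuous (fun p : R * R => normc (E (p.1 +i* p.2))).
Proof.
move=> cE; apply: (continuous_plane (f := fun z => normc (E z))) => z e e0.
have [r r0 hr] := cE z e e0; exists r => // h /hr; apply: le_trans.
have := le_normcD (E (z + h) - E z) (E z); have := le_normcD (E z - E (z + h)) (E (z + h)).
by rewrite !subrK (normcB (E z)) ler_norml => h1 h2; lra.
Qed.

Definition root4 (x : R) := Num.sqrt (Num.sqrt x).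

Lemma root4_ge0 x : 0 <= root4 x. Proof. exact: sqrtr_ge0. Qed.

Lemma root4_gt0 x : 0 < x -> 0 < root4 x. Proof. by move=> x0; rewrite !sqrtr_gt0. Qed.

Lemma root4K x : 0 <= x -> root4 x ^+ 4 = x.
Proof.
by move=> x0; rewrite -[4%N]/(2 * 2)%N exprM !sqr_sqrtr// sqrtr_ge0.
Qed.

Lemma continuous_root4 : continuous root4.
Proof.
by move=> x; apply: (@continuous_comp _ _ _ Num.sqrt Num.sqrt); exact: sqrt_continuous.
Qed.
End PicardTheorem.

Section Picard2.
Variable R : realType.
Local Notation C := R[i].
Implicit Types (E F : C -> C) (z th : C).

Lemma continuous_expn (T : topologicalType) (f : T -> R) n (x : T) :
  {for x, continuous f} -> {for x, continuous (fun y => f y ^+ n)}.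
Proof.
move=> cf; elim: n => [|n IH]; first exact: cvg_cst.
rewrite (_ : (fun y => _) = fun y => f y * f y ^+ n); last by apply/funext => y; rewrite exprS.
exact: cvgM.
Qed.

Lemma expR_ln8 z : z != 0 -> expR (8^-1 * ln (nsq z)) = root4 (normc z).
Proof.
move=> z0; have n0 : 0 < normc z by rewrite normc_gt0.
have P0 := root4_gt0 n0.
have -> : nsq z = root4 (normc z) ^+ 8.
  by rewrite nsqE -{1}(root4K (ltW n0)) -exprM.
rewrite lnXn// -[ln _ *+ 8]mulr_natl mulrA mulVf ?pnatr_eq0// mul1r.
by rewrite lnK.
Qed.

Section Metric.
Variables (E : C -> C) (kap : C -> R).
Hypotheses (eE : entire E) (E0 : forall z, E z != 0).
Hypothesis kap_cont : forall z (e : R), 0 < e -> exists2 r : R, 0 < r &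
  forall h, normc h < r -> `|kap (z + h) - kap z| <= e.
Hypothesis kap_ge0 : forall z, 0 <= kap z.
Hypothesis kapE : forall z, normc (cD E z) ^+ 8 = kap z * normc (E z - 1) ^+ 7.
Hypothesis kap0 : forall z, E z = 1 -> kap z = 0.

Let P z := root4 (normc (E z)).
Let Q z := root4 (normc (E z - 1)).
(** Where [E <> 1] this is [nsq (cD E z) * (1 + P z) * (1 + Q z) / (P z * Q z) ^+ 7], the square of
    the density; writing it with [kap] extends it continuously to the points where [E = 1]. *)
Let rho z := root4 (kap z) * (1 + P z) * (1 + Q z) / P z ^+ 7.

Let P_gt0 z : 0 < P z. Proof. by rewrite root4_gt0// normc_gt0. Qed.
Let Q_ge0 z : 0 <= Q z. Proof. exact: root4_ge0. Qed.
Let rho_ge0 z : 0 <= rho z.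
Proof.
apply: divr_ge0; last by rewrite exprn_ge0// ltW.
by rewrite !mulr_ge0 ?root4_ge0//; [have := P_gt0 z; lra|have := Q_ge0 z; lra].
Qed.

Let PQ_ge1 z : 1 <= P z ^+ 4 + Q z ^+ 4.
Proof.
rewrite !root4K ?normc_ge0//.
have := le_normcD (E z) (- (E z - 1)); rewrite normcN.
have -> : E z + - (E z - 1) = 1 by ring.
by rewrite normc1.
Qed.

Let kapQ z : root4 (kap z) * Q z ^+ 7 = nsq (cD E z).
Proof.
apply/eqP; rewrite -(@eqrXn2 _ 4)// ?mulr_ge0 ?root4_ge0 ?exprn_ge0//; last first.
  by rewrite nsqE exprn_ge0// normc_ge0.
rewrite exprMn root4K// -exprM mulnC exprM root4K ?normc_ge0//.
by rewrite -kapE nsqE -exprM.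
Qed.

Let eE1 : entire (fun z => E z - 1).
Proof. by move=> z; have [d h] := eE z; eexists; exact: (cderB h (cder_cst _ _)). Qed.

Let cD1 z : cD (fun z => E z - 1) z = cD E z.
Proof.
by apply: cderD1; rewrite -[cD E z]subr0; exact: (cderB (entireD1 z eE) (cder_cst _ _)).
Qed.

Variable r : R.
Hypothesis r0 : 0 < r.
Let g z := r ^+ 2 - nsq z.

(* The logarithm of [rho * g ^+ 2] along a line, whose second derivatives in the directions [1] and
   ['i] add up to the Laplacian. *)
Let Lam (z th : C) (t : R) :=
  ln (nsq (cD E (z + t%:C * th))) + (- (7 * 8^-1) * ln (nsq (E (z + t%:C * th) - 1))
  + (- (7 * 8^-1) * ln (nsq (E (z + t%:C * th)))
  + (ln (1 + expR (8^-1 * ln (nsq (E (z + t%:C * th)))))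
  + (ln (1 + expR (8^-1 * ln (nsq (E (z + t%:C * th) - 1))))
  + 2 * ln (g (z + t%:C * th)))))).

Let LamE z th t (w := z + t%:C * th) : cD E w != 0 -> E w != 1 -> 0 < g w ->
  expR (Lam z th t) = rho w * g w ^+ 2.
Proof.
move=> D0 E1 g0; rewrite /Lam -/w.
have E1' : E w - 1 != 0 by rewrite subr_eq0.
rewrite !expR_ln8// -/(P w) -/(Q w) !expRD.
have h (x : C) : x != 0 -> expR (- (7 * 8^-1) * ln (nsq x)) = (root4 (normc x) ^+ 7)^-1.
  by move=> x0; rewrite mulNr expRN -mulrA (expRM_natl 7) expR_ln8.
rewrite !h// (expRM_natl 2) !lnK ?posrE ?nsq_gt0//; last 2 first.
- by rewrite ltr_pwDl// root4_ge0.
- by rewrite ltr_pwDl// root4_ge0.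
rewrite -/(P w) -/(Q w) -kapQ /rho.
have Q0 : 0 < Q w by rewrite root4_gt0// normc_gt0.
by field; rewrite !lt0r_neq0.
Qed.

(** At a maximum the Laplacian of [Lam] is not positive. The two softplus terms contribute [1/16] of
    the left-hand side to it, and [2 * ln g] contributes [- 8 * r ^+ 2 / g z ^+ 2]; hence
    [128 = 16 * 8]. *)
Let Lam_max z : cD E z != 0 -> E z != 1 -> 0 < g z ->
  (forall th, nsq th = 1 -> exists2 s : R, 0 < s & forall t, `|t| < s -> Lam z th t <= Lam z th 0) ->
  nsq (cD E z) / (P z ^+ 7 * (1 + P z) ^+ 2) + nsq (cD E z) / (Q z ^+ 7 * (1 + Q z) ^+ 2)
    <= 128 * (r ^+ 2 / g z ^+ 2).
Proof.
move=> D0 E1 g0 HM.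
have E1' : E z - 1 != 0 by rewrite subr_eq0.
have Q0 : 0 < Q z by rewrite root4_gt0// normc_gt0.
have B th (nt : nsq th = 1) :=
  let: ex_intro2 s s0 hs := HM th nt in
  d2_max (d2D (d2_logn th (entire_cD eE) D0) (d2D (d2Z (- (7 * 8^-1)) (d2_logn th eE1 E1'))
    (d2D (d2Z (- (7 * 8^-1)) (d2_logn th eE (E0 z))) (d2D (d2_softplus (d2_logn th eE (E0 z)))
    (d2D (d2_softplus (d2_logn th eE1 E1')) (d2Z 2 (d2_disc nt g0))))))) s0 hs.
have n1 : nsq (1 : C) = 1 by rewrite /nsq /=; ring.
have ni : nsq ('i : C) = 1 by rewrite /nsq /=; ring.
have B1 := B 1 n1; have Bi := B 'i ni; move: B1 Bi.
rewrite !line0 !expR_ln8// !cD1 -/(P z) -/(Q z) -/(g z).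
have nL (w : C) : nsq (cD E z / w) = nsq (cD E z) / nsq w.
  by rewrite !nsqE normcM normcV exprMn exprVn.
have := nL (E z); have := nL (E z - 1).
have -> : nsq (E z) = P z ^+ 8 by rewrite nsqE -{1}(root4K (normc_ge0 (E z))) -exprM.
have -> : nsq (E z - 1) = Q z ^+ 8 by rewrite nsqE -{1}(root4K (normc_ge0 (E z - 1))) -exprM.
have R1 (w : C) : Re (1 * w) = Re w by rewrite mul1r.
have R2 (w : C) : Re (1 ^+ 2 * w) = Re w by rewrite expr1n mul1r.
have R3 (w : C) : Re ('i * w) = - Im w by case: w => a b; simpc.
have R4 (w : C) : Re ('i ^+ 2 * w) = - Re w by rewrite sqr_i mulN1r raddfN.
rewrite !R1 !R2 !R3 !R4 /nsq.
have -> : Re (1 : C) = 1 by []. have -> : Im (1 : C) = 0 by [].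
have -> : Re ('i : C) = 0 by []. have -> : Im ('i : C) = 1 by [].
rewrite -/(nsq (cD E z)).
have gz : r ^+ 2 = g z + (Re z ^+ 2 + Im z ^+ 2) by rewrite /g /nsq subrK.
rewrite gz; move: (P_gt0 z) Q0 g0.
move: (P z) (Q z) (g z) (nsq (cD E z)) => p q G N.
move: (Re (cD E z / E z)) (Im (cD E z / E z)) (Re (cD E z / (E z - 1))) (Im (cD E z / (E z - 1))).
do 3![move: (Re (_ / _))].
move: (Re z) (Im z) => x y a1 a2 a3 l1 l2 l3 l4 p0 q0 G0 hQ hP b1 b2.
have np : 1 + p != 0 by rewrite lt0r_neq0// addr_gt0.
have nq : 1 + q != 0 by rewrite lt0r_neq0// addr_gt0.
have np0 : p != 0 by exact: lt0r_neq0.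
have nq0 : q != 0 by exact: lt0r_neq0.
have nG : G != 0 by exact: lt0r_neq0.
(* Adding the directions [1] and ['i] forms the Laplacian; the harmonic parts [a1], [a2], [a3]
   cancel. *)
have sumE := lerD b1 b2; rewrite addr0 in sumE.
rewrite -subr_le0 -(pmulr_rle0 _ (_ : 0 < 16^-1)) ?invr_gt0//.
apply: le_trans sumE; rewrite le_eqVlt; apply/orP; left; apply/eqP.
have -> : N / (p ^+ 7 * (1 + p) ^+ 2) = p / (1 + p) ^+ 2 * (N / p ^+ 8).
  by field; rewrite np np0.
have -> : N / (q ^+ 7 * (1 + q) ^+ 2) = q / (1 + q) ^+ 2 * (N / q ^+ 8).
  by field; rewrite nq nq0.
by rewrite -hP -hQ; field; rewrite np nq nG.
Qed.

(* [g z + `|g z|] is [2 g z] on the disc and [0] outside of it, so that the maximum of [w] on the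
   square is reached in the disc. *)
Let w z := rho z * (g z + `|g z|) ^+ 2.

Let w_cont : continuous (fun p : R * R => w (p.1 +i* p.2)).
Proof.
have cP : continuous (fun p : R * R => P (p.1 +i* p.2)).
  move=> p; apply: (@continuous_comp _ _ _ (fun p : R * R => normc (E (p.1 +i* p.2))) (@root4 R)).
    exact: continuous_normc (entire_ccont eE) p.
  exact: continuous_root4.
have cQ : continuous (fun p : R * R => Q (p.1 +i* p.2)).
  move=> p; apply: (@continuous_comp _ _ _ (fun p : R * R => normc (E (p.1 +i* p.2) - 1)) (@root4 R)).
    exact: (continuous_normc (entire_ccont eE1)).
  exact: continuous_root4.
have ck : continuous (fun p : R * R => root4 (kap (p.1 +i* p.2))).
  move=> p; apply: (@continuous_comp _ _ _ (fun p : R * R => kap (p.1 +i* p.2)) (@root4 R)).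
    exact: (continuous_plane kap_cont).
  exact: continuous_root4.
have cg : continuous (fun p : R * R => g (p.1 +i* p.2)).
  move=> p; rewrite /g /nsq /=; apply: cvgB; first exact: cvg_cst.
  apply: cvgD.
    by apply: (@continuous_expn _ (fun p : R * R => p.1) 2 p); exact: cvg_fst.
  by apply: (@continuous_expn _ (fun p : R * R => p.2) 2 p); exact: cvg_snd.
have cg2 : continuous (fun p : R * R => g (p.1 +i* p.2) + `|g (p.1 +i* p.2)|).
  by move=> p; apply: cvgD; [exact: cg|apply: cvg_norm; exact: cg].
have c1P : continuous (fun p : R * R => 1 + P (p.1 +i* p.2)).
  by move=> p; apply: cvgD; [exact: cvg_cst|exact: cP].
have c1Q : continuous (fun p : R * R => 1 + Q (p.1 +i* p.2)).
  by move=> p; apply: cvgD; [exact: cvg_cst|exact: cQ].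
have cV : continuous (fun p : R * R => (P (p.1 +i* p.2) ^+ 7)^-1).
  move=> p; apply: cvgV; first by rewrite expf_neq0// lt0r_neq0.
  exact: (continuous_expn (n := 7) (cP p)).
move=> p.
exact: (cvgM (cvgM (cvgM (cvgM (ck p) (c1P p)) (c1Q p)) (cV p)) (continuous_expn (n := 2) (cg2 p))).
Qed.

(** At a point [z] where [rho * g ^+ 2] is maximal on the disc, [Lam_max] and [metric_bound] bound
    [rho z * g z ^+ 2] by [648 * 128 * r ^+ 2]. At the center this function is [rho 0 * r ^+ 4]. *)
Lemma metric_center : rho 0 <= 648 * 128 / r ^+ 2.
Proof.
have [p0 _ Hp] : exists2 p0 : R * R, p0 \in `[- r, r] `*` `[- r, r] &
    forall p, p \in `[- r, r] `*` `[- r, r] -> w (p.1 +i* p.2) <= w (p0.1 +i* p0.2).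
  apply: compact_EVT_max.
  - by exists (0, 0); split => /=; rewrite in_itv/= oppr_le0 (ltW r0).
  - by apply: compact_setX; exact: segment_compact.
  - exact: continuous_subspaceT.
set z := p0.1 +i* p0.2 in Hp.
have gE0 : g 0 = r ^+ 2 by rewrite /g /nsq /= expr0n addr0 subr0.
have w0 : w 0 = 4 * (rho 0 * r ^+ 4).
  by rewrite /w gE0 ger0_norm ?sqr_ge0//; ring.
have w0z : w 0 <= w z.
  by apply: (Hp (0, 0)); rewrite inE; split => /=; rewrite in_itv/= oppr_le0 (ltW r0).
have r2 : 0 < r ^+ 2 by rewrite exprn_gt0.
have [wz|wz] := leP (w z) 0.
  apply: (@le_trans _ _ 0); last by apply: divr_ge0 (ltW r2); apply: mulr_ge0; exact: ler0n.
  have := le_trans w0z wz; rewrite w0 pmulr_rle0// pmulr_lle0// exprn_gt0//.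
have gz : 0 < g z.
  rewrite ltNge; apply/negP => gz; move: wz.
  by rewrite /w ler0_norm// subrr expr0n mulr0 ltxx.
have rz : 0 < rho z.
  rewrite lt0r rho_ge0 andbT; apply/eqP => rz; move: wz.
  by rewrite /w rz mul0r ltxx.
(* Positivity of [w z] keeps [z] away from the singularities of [Lam]: [kap] vanishes where [E = 1],
   and also where [cD E] vanishes with [E <> 1]. *)
have kz : kap z != 0.
  apply/eqP => kz; move: rz.
  by rewrite /rho kz /root4 !sqrtr0 !mul0r ltxx.
have E1 : E z != 1 by apply/eqP => /kap0 k0; rewrite k0 eqxx in kz.
have D0 : cD E z != 0.
  apply/eqP => D0; move: (kapE z); rewrite D0 normc0 expr0n => /esym/eqP.
  rewrite mulf_eq0 (negbTE kz) expf_eq0 /= => /eqP/eq0_normc/eqP.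
  by rewrite subr_eq0 (negbTE E1).
have HM th : nsq th = 1 -> exists2 s : R, 0 < s & forall t, `|t| < s -> Lam z th t <= Lam z th 0.
  move=> nt; have [s1 s10 h1] := near_line_neq0 th (entire_cD eE) D0.
  have [s2 s20 h2] : exists2 s : R, 0 < s & forall t : R, `|t| < s -> E (z + t%:C * th) - 1 != 0.
    by apply: (near_line_neq0 (F := fun z => E z - 1) th eE1); rewrite subr_eq0.
  have [s3 s30 h3] : exists2 s : R, 0 < s & forall t : R, `|t| < s -> 0 < g (z + t%:C * th).
    have := cder_pos_near (f := fun t : R => g (z + t%:C * th)) (z := 0).
    have e t : g (z + t%:C * th) = r ^+ 2 - (Re (id (z + t%:C * th)) ^+ 2 + Im (id (z + t%:C * th)) ^+ 2) by [].
    have di t := cder_id (z + t%:C * th).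
    have := cderB (cder_cst (r ^+ 2) 0) (cderD (cderX 1 (cderRe (di 0))) (cderX 1 (cderIm (di 0)))).
    move=> dg /(_ _ dg); rewrite line0 => /(_ gz)[s s0 hs].
    by exists s => // t /hs; rewrite add0r.
  exists (Num.min s1 (Num.min s2 s3)); first by rewrite !lt_min s10 s20.
  move=> t; rewrite !lt_min => /and3P[/h1 D /h2 E2 /h3 G].
  rewrite -ler_expR !LamE ?line0//; last by rewrite -subr_eq0.
  have pos4 x : 0 < g x -> rho x * g x ^+ 2 = w x / 4.
    by move=> gx; rewrite /w gtr0_norm//; field.
  rewrite !pos4// ler_pM2r ?invr_gt0//.
  case eu : (z + t%:C * th) G => [a b] G.
  apply: (Hp (a, b)); rewrite inE; move: G; rewrite /g /nsq /= subr_gt0 => G.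
  have a2 : a ^+ 2 < r ^+ 2 by apply: le_lt_trans G; rewrite lerDl sqr_ge0.
  have b2 : b ^+ 2 < r ^+ 2 by apply: le_lt_trans G; rewrite lerDr sqr_ge0.
  have sq (x : R) : x ^+ 2 < r ^+ 2 -> - r <= x <= r.
    move=> h; rewrite -ler_norml ltW// -(ltr_pXn2r (n := 2)) ?nnegrE ?(ltW r0)//.
    by rewrite real_normK// num_real.
  by split; rewrite /= in_itv/=; exact: sq.
have Qz : 0 < Q z by rewrite root4_gt0// normc_gt0 subr_eq0.
have := metric_bound (P_gt0 z) Qz _ (PQ_ge1 z) (Lam_max D0 E1 gz HM).
rewrite -{2}kapQ mulfK; last by rewrite expf_neq0// lt0r_neq0.
rewrite -/(rho z) => /(_ _) H; have {H} : rho z <= 648 * (128 * (r ^+ 2 / g z ^+ 2)).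
  by apply: H; rewrite nsqE exprn_ge0// normc_ge0.
rewrite !mulrA ler_pdivlMr ?exprn_gt0// => H0.
have H : rho z * g z ^+ 2 <= 648 * 128 * r ^+ 2 by rewrite [r ^+ 2]expr2 [leRHS]mulrA.
move: w0z; rewrite w0 /w gtr0_norm// => w0z.
rewrite ler_pdivlMr//.
have H3 : rho 0 * r ^+ 2 * r ^+ 2 <= 648 * 128 * r ^+ 2.
  apply: le_trans H; move: w0z; have -> : rho z * (g z + g z) ^+ 2 = 4 * (rho z * g z ^+ 2) by ring.
  rewrite ler_pM2l// => w0z; apply: le_trans w0z.
  by rewrite le_eqVlt; apply/orP; left; apply/eqP; ring.
by move: H3; rewrite ler_pM2r.
Qed.
End Metric.
End Picard2.

(** * Constancy of entire functions with omitted or ramified values *)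

Section PicardCorollaries.
Variable R : realType.
Local Notation C := R[i].
Implicit Types (E F B V : C -> C) (z : C).

Lemma entire_cst (c : C) : entire (fun=> c).
Proof. by move=> z; exists 0; exact: cder_cst. Qed.

Lemma entireD E F : entire E -> entire F -> entire (fun z => E z + F z).
Proof. by move=> h k z; have [d ?] := h z; have [d' ?] := k z; exists (d + d'); exact: cderD. Qed.

Lemma entireN E : entire E -> entire (fun z => - E z).
Proof. by move=> h z; have [d ?] := h z; exists (- d); exact: cderN. Qed.

Lemma entireB E F : entire E -> entire F -> entire (fun z => E z - F z).
Proof. by move=> h k; apply: entireD => //; exact: entireN. Qed.

Lemma entireM E F : entire E -> entire F -> entire (fun z => E z * F z).
Proof. by move=> h k z; have [d ?] := h z; have [d' ?] := k z; exists (d * F z + E z * d'); exact: cderM. Qed.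

Lemma entireX E n : entire E -> entire (fun z => E z ^+ n).
Proof.
move=> h; elim: n => [|n IH]; first exact: entire_cst.
rewrite (_ : (fun z => _) = fun z => E z * E z ^+ n); first exact: entireM.
by apply/funext => z; rewrite exprS.
Qed.

Lemma cD_eq0_cst E : entire E -> (forall z, cD E z = 0) -> forall z w, E z = E w.
Proof.
move=> eE D0 z w.
have dl (t : R) : cder E (z + t%:C * (w - z)) 0 by have := entireD1 (z + t%:C * (w - z)) eE; rewrite D0.
have i0 : (0 : R) \in `](-1), 2[ by rewrite in_itv/=; lra.
have i1 : (1 : R) \in `](-1), 2[ by rewrite in_itv/=; lra.
have dr t : cder (fun t : R => Re (E (z + t%:C * (w - z)))) t 0.
  by have := cderRe (dl t); rewrite mul0r [Re 0]/=.
have di t : cder (fun t : R => Im (E (z + t%:C * (w - z)))) t 0.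
  by have := cderIm (dl t); rewrite mul0r [Im 0]/=.
have := cder_eq_cst (fun t _ => dr t) (fun t _ => cder_cst 0 t) i0 i1.
have := cder_eq_cst (fun t _ => di t) (fun t _ => cder_cst 0 t) i0 i1.
rewrite !subr0 line0 (rmorph1 (real_complex R)) mul1r (addrC z) subrK.
by case: (E z) => a b; case: (E w) => c d /= -> ->.
Qed.

Lemma le_inv_sqr_eq0 (x M : R) : 0 <= x -> (forall r, 0 < r -> x <= M / r ^+ 2) -> x = 0.
Proof.
move=> x0 H; apply/eqP; rewrite eq_le x0 andbT leNgt; apply/negP => xp.
have M0 : 0 < M by have := H 1 ltr01; rewrite expr1n divr1; exact: lt_le_trans.
pose r := (M / x) + 1.
have r0 : 0 < r by rewrite addr_gt0// divr_gt0.
have := H r r0; rewrite ler_pdivlMr ?exprn_gt0// leNgt => /negP; apply.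
have h : x * r = M + x by rewrite /r; field; exact: lt0r_neq0.
have r1 : 1 < r by rewrite /r ltrDr divr_gt0.
rewrite expr2 mulrA h; nra.
Qed.

(* Where [E - 1] has a zero of order [m], [kap] vanishes to the order [m - 8]: the assumptions on
   [kap] say that the value [1] is taken with multiplicity larger than [8] only. *)
Theorem picard_ramified E (kap : C -> R) : entire E -> (forall z, E z != 0) ->
  (forall z (e : R), 0 < e -> exists2 r : R, 0 < r &
    forall h, normc h < r -> `|kap (z + h) - kap z| <= e) ->
  (forall z, 0 <= kap z) ->
  (forall z, normc (cD E z) ^+ 8 = kap z * normc (E z - 1) ^+ 7) ->
  (forall z, E z = 1 -> kap z = 0) -> forall z w, E z = E w.
Proof.
move=> eE E0 kc k0 kE k1; apply: cD_eq0_cst => // c.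
(* The estimate concerns the center of discs, so [c] is moved to the origin. As [r] grows the
   density there is forced to be [0], hence [kap] and the derivative vanish at [c]. *)
pose F z := E (z + c).
have dF z : cder F z (cD E (z + c)).
  have -> : cD E (z + c) = cD E (z + c) * (1 + 0) by rewrite addr0 mulr1.
  exact: (cder_comp (F := fun z => z + c) (entireD1 (z + c) eE) (cderD (cder_id _) (cder_cst _ _))).
have cDF z : cD F z = cD E (z + c) by exact: cderD1 (dF z).
have H := @metric_center R F (fun z => kap (z + c))
   (fun z => ex_intro _ _ (dF z)) (fun z => E0 (z + c)).
have kc' z (e : R) : 0 < e -> exists2 r : R, 0 < r &
    forall h, normc h < r -> `|kap (z + h + c) - kap (z + c)| <= e.
  by move=> e0; have [r r0 hr] := kc (z + c) e e0; exists r => // h /hr; rewrite addrAC.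
have kE' z : normc (cD F z) ^+ 8 = kap (z + c) * normc (F z - 1) ^+ 7 by rewrite cDF; exact: kE.
have {}H := H kc' (fun z => k0 (z + c)) kE' (fun z => k1 (z + c)).
have P0 : 0 < root4 (normc (F 0)) by rewrite root4_gt0// normc_gt0 E0.
have Q0 : 0 <= root4 (normc (F 0 - 1)) by exact: root4_ge0.
have := le_inv_sqr_eq0 _ H; set rho := (X in 0 <= X -> _).
have rho0 : 0 <= rho.
  apply: divr_ge0; last by rewrite exprn_ge0// ltW.
  by rewrite !mulr_ge0 ?root4_ge0//; lra.
move=> /(_ rho0)/eqP; rewrite /rho mulf_eq0 invr_eq0 expf_eq0 /= (gt_eqF P0) orbF.
rewrite -mulrA mulf_eq0 [X in _ || X](_ : _ = false) ?orbF; last first.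
  by apply/eqP/eqP; rewrite lt0r_neq0// mulr_gt0//; lra.
move=> /eqP k40; have kc0 : kap (0 + c) = 0 by rewrite -(root4K (k0 (0 + c))) k40 expr0n.
have := kE' 0; rewrite kc0 mul0r cDF add0r => /eqP.
by rewrite expf_eq0 /= => /eqP/eq0_normc.
Qed.

Lemma normc_cont E : entire E -> forall z (e : R), 0 < e -> exists2 r : R, 0 < r &
  forall h, normc h < r -> `|normc (E (z + h)) - normc (E z)| <= e.
Proof.
move=> /entire_ccont cE z e e0; have [r r0 hr] := cE z e e0; exists r => // h /hr; apply: le_trans.
have := le_normcD (E (z + h) - E z) (E z); have := le_normcD (E z - E (z + h)) (E (z + h)).
by rewrite !subrK (normcB (E z)) ler_norml => h1 h2; lra.
Qed.

Corollary picard_power B V : entire B -> entire V ->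
  (forall z, 1 + B z ^+ 11 * V z ^+ 10 != 0) ->
  forall z w, B z ^+ 11 * V z ^+ 10 = B w ^+ 11 * V w ^+ 10.
Proof.
move=> eB eV E0 z w; apply: (addrI 1).
(* The derivative of [B ^+ 11 * V ^+ 10] is [B ^+ 10 * V ^+ 9 * T]; its eighth power is [K] times
   the seventh power of [B ^+ 11 * V ^+ 10]. The remaining factors [B ^+ 3] and [V ^+ 2] make [K]
   vanish where the value [1] is taken. *)
pose T x := 11%:R * cD B x * V x + 10%:R * B x * cD V x.
pose K x := B x ^+ 3 * V x ^+ 2 * T x ^+ 8.
have eT : entire T.
  by apply: entireD; apply: entireM => //; try exact: entire_cD; apply: entireM;
    first [exact: entire_cst|exact: entire_cD|done].
have eK : entire K by apply: entireM; [apply: entireM; exact: entireX|exact: entireX].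
have eE : entire (fun z => 1 + B z ^+ 11 * V z ^+ 10).
  by apply: entireD; [exact: entire_cst|apply: entireM; exact: entireX].
apply: (picard_ramified (E := fun z => 1 + B z ^+ 11 * V z ^+ 10) (kap := fun x => normc (K x))) => //.
- exact: normc_cont.
- by move=> x; exact: normc_ge0.
- move=> x; have -> : cD (fun z => 1 + B z ^+ 11 * V z ^+ 10) x = B x ^+ 10 * V x ^+ 9 * T x.
    have h := cderD (cder_cst (1 : C) x) (cderM (cderX 10 (entireD1 x eB)) (cderX 9 (entireD1 x eV))).
    apply: (etrans (cderD1 h)); rewrite /T.
    move: (B x) (V x) (cD B x) (cD V x) => b v b' v'.
    ring.
  rewrite (addrC 1) addrK -!normcX -normcM; congr (normc _); rewrite /K.
  move: (B x) (V x) (T x) => b v u.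
  ring.
- move=> x /eqP; rewrite -subr_eq0 (addrC 1) addrK mulf_eq0 !expf_eq0 /= /K => /orP[]/eqP ->.
    by rewrite expr0n !mul0r normc0.
  by rewrite expr0n mulr0 mul0r normc0.
Qed.

(** An affine change of the target moves [a] and [b] to [0] and [1]. As [1] is then omitted, [kap]
    is an honest quotient and its condition at the value [1] is vacuous. *)
Corollary picard_omit2 E (a b : C) : entire E -> a != b ->
  (forall z, E z != a) -> (forall z, E z != b) -> forall z w, E z = E w.
Proof.
move=> eE ab Ea Eb z w.
pose c := (b - a)^-1; have c0 : c != 0 by rewrite invr_eq0 subr_eq0 eq_sym.
pose F x := c * (E x - a).
have eF : entire F.
  by apply: entireM; [exact: entire_cst|apply: entireB => //; exact: entire_cst].
have F1 x : F x - 1 != 0.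
  rewrite (_ : F x - 1 = c * (E x - b)); first by rewrite mulf_neq0// subr_eq0.
  by rewrite /F /c; field; rewrite subr_eq0 eq_sym.
have eF1 : entire (fun x => F x - 1) by apply: entireB => //; exact: entire_cst.
have eK : entire (fun x => cD F x ^+ 8) by apply: entireX; exact: entire_cD.
suff FE : F z = F w.
  by move: FE; rewrite /F => /(mulfI c0) /(addIr (- a)).
apply: (picard_ramified (E := F) (kap := fun x => normc (cD F x ^+ 8 / (F x - 1) ^+ 7))) => //.
- by move=> x; rewrite mulf_neq0// subr_eq0.
- have eQ : entire (fun x => cD F x ^+ 8 * ((F x - 1) ^+ 7)^-1).
    apply: entireM => // x; have [d dF] := entireX 7 eF1 x.
    have nz : (F x - 1) ^+ 7 != 0 by rewrite expf_neq0.
    by eexists; exact: (cderV (E := fun x => (F x - 1) ^+ 7) nz dF).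
  exact: (normc_cont eQ).
- by move=> x; exact: normc_ge0.
- by move=> x; rewrite -!normcX -normcM divfK ?expf_neq0.
- by move=> x Fx; exfalso; have := F1 x; rewrite Fx subrr eqxx.
Qed.
End PicardCorollaries.

(** * Differentials of functions of several variables *)

Section Differentials.
Variables (K : numFieldType) (n : nat).
Local Notation V := 'rV[K]_n.+1.
Implicit Types (f h : V -> K) (F G : V -> V) (p q w e : V).

Lemma cder_line f p w (t : K) : differentiable f (p + t *: w) ->
  cder (fun t => f (p + t *: w)) t ('d f (p + t *: w) w).
Proof.
move=> df.
have dl : is_diff t (fun t : K => p + t *: w) (fun t => t *: w).
  rewrite (_ : (fun t => t *: w) = 0 + (fun t => t *: w)); last by rewrite add0r.
  exact: (@is_diffD _ _ _ (cst p) (fun t : K => t *: w)).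
have [d1 d2] := dl.
have dc : differentiable (f \o (fun t : K => p + t *: w)) t by exact: differentiable_comp.
split; first exact/derivable1_diffP.
by rewrite (deriveE _ dc) (diff_comp d1 df) /= d2 scale1r.
Qed.

Lemma diff_line_cst f p w : differentiable f p -> (forall t, f (p + t *: w) = f p) ->
  'd f p w = 0.
Proof.
move=> df H; have df0 : differentiable f (p + (0 : K) *: w) by rewrite scale0r addr0.
have := cder_line df0; rewrite scale0r addr0 => h.
rewrite -(cderD1 h); apply: cderD1.
by apply: cder_ext (cder_cst (f p) 0) => t; rewrite H.
Qed.

Lemma differentiable_coord0 F p j : differentiable F p -> differentiable (fun x => F x 0 j) p.
Proof.
move=> dF; apply: (@differentiable_comp _ _ _ _ F (fun y : V => y 0 j)) => //.
exact: differentiable_coord.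
Qed.

Lemma diff_coord p e j : 'd (fun y : V => y 0 j) p e = e 0 j.
Proof.
have df t : differentiable (fun y : V => y 0 j) (p + t *: e) by exact: differentiable_coord.
have := cder_line (df 0); rewrite scale0r addr0 => h.
rewrite -(cderD1 h); apply: cderD1.
have := cderD (cder_cst (p 0 j) 0) (cderM (cder_id 0) (cder_cst (e 0 j) 0)).
rewrite add0r mul1r mulr0 addr0; apply: cder_ext => t.
by rewrite !mxE.
Qed.

(* ['d F p] maps the hyperplane of tangent vectors with [j]-th coordinate [0] onto itself, and
   ['d (h \o F) p] is zero on it. *)
Lemma tangent_transfer F G h (j : 'I_n.+1) p : cancel F G -> cancel G F ->
  differentiable F p -> differentiable G (F p) -> differentiable h (F p) ->
  (forall e, e 0 j = 0 -> 'd (fun x => h (F x)) p e = 0) ->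
  (forall e, e 0 j = 0 -> 'd (fun x => F x 0 j) p e = 0) ->
  forall e, e 0 j = 0 -> 'd h (F p) e = 0.
Proof.
move=> FK GK dF dG dh Hh Hb.
pose d0 : V := delta_mx 0 j.
have key f : differentiable f (F p) -> (forall e, e 0 j = 0 -> 'd (fun x => f (F x)) p e = 0) ->
    forall e, 'd f (F p) e = ('d G (F p) e) 0 j * 'd (fun x => f (F x)) p d0.
  move=> df Hf e; set e' := 'd G (F p) e.
  have dfF : differentiable (fun x => f (F x)) p by exact: (@differentiable_comp _ _ _ _ F f).
  have E0 : 'd f (F p) e = 'd (fun x => f (F x)) p e'.
    have dfF' : differentiable (fun x => f (F x)) (G (F p)) by rewrite FK.
    have fE : (fun x => f (F x)) \o G = f by apply/funext => x /=; rewrite GK.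
    have := diff_comp dG dfF'; rewrite fE FK => E1.
    by have := congr1 (fun L : V -> K => L e) E1.
  apply: (etrans E0); move: (e') => {E0}c'.
  have E2 : 'd (fun x => f (F x)) p (c' 0 j *: d0 + (c' - c' 0 j *: d0)) = c' 0 j * 'd (fun x => f (F x)) p d0.
    have Hr : 'd (fun x => f (F x)) p (c' - c' 0 j *: d0) = 0.
      by apply: Hf; rewrite !mxE !eqxx mulr1 subrr.
    by rewrite linearD Hr addr0 linearZ.
  by rewrite -E2 addrC subrK.
(* [key] for the coordinate [j] itself: at [e = d0] it shows that the constant factor is not [0],
   and then that the differential of [G] preserves the hyperplane. *)
have lam e : e 0 j = ('d G (F p) e) 0 j * 'd (fun x => F x 0 j) p d0.
  exact: etrans (esym (diff_coord (F p) e j)) (key _ (differentiable_coord (F p) 0 j) Hb e).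
have alg (l m u k : K) : 1 = u * l -> 0 = k * l -> k * m = 0.
  move=> h1 /esym/eqP; rewrite mulf_eq0 => /orP[/eqP ->|/eqP l0]; first by rewrite mul0r.
  by move: h1; rewrite l0 mulr0 => /eqP; rewrite oner_eq0.
move=> e e0; apply: (etrans (key h dh Hh e)).
by apply: alg (etrans _ (lam d0)) (etrans (esym e0) (lam e)); rewrite mxE !eqxx.
Qed.

Lemma diff_delta f p (j : 'I_n.+1) : differentiable f p ->
  (forall i, i != j -> 'd f p (delta_mx 0 i) = 0) -> forall e, e 0 j = 0 -> 'd f p e = 0.
Proof.
move=> df H e e0; rewrite (row_sum_delta e) linear_sum big1// => i _.
by rewrite linearZ /=; have [->|/H ->] := eqVneq i j; rewrite ?e0 ?scale0r ?scaler0.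
Qed.
End Differentials.

(** Induction along the ring operations suits properties that pass to sums and products, such as
    differentiability or the behaviour under substitution. *)
Lemma mpoly_ring_ind (A : nzRingType) n (P : {mpoly A[n]} -> Prop) :
  (forall c, P c%:MP) -> (forall i, P 'X_i) ->
  (forall p q, P p -> P q -> P (p + q)) -> (forall p q, P p -> P q -> P (p * q)) ->
  forall p, P p.
Proof.
move=> PC PX PD PM; elim/mpolyind => [|a m p _ _ IH]; first by rewrite -mpolyC0.
apply: (PD _ _ _ IH); rewrite -mul_mpolyC; apply: (PM _ _ (PC a)); rewrite mpolyXE_id.
apply: (big_ind P); [by rewrite -mpolyC1|exact: PM|].
move=> j _; elim: (m j) => [|k IHk]; first by rewrite expr0 -mpolyC1.
by rewrite exprS; apply: (PM _ _ (PX j)).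
Qed.

(** * Polynomial maps as holomorphic maps *)

Section PolynomialMaps.
Variables (K : numClosedFieldType).

Lemma differentiable_meval n (p : {mpoly K[n.+1]}) (x : 'rV[K]_n.+1) :
  differentiable (fun x : 'rV[K]_n.+1 => p.@[x 0]) x.
Proof.
elim/mpoly_ring_ind: p => [c|i|p q IHp IHq|p q IHp IHq].
- rewrite (_ : (fun x => _) = cst c); first exact: differentiable_cst.
  by apply/funext => y; rewrite mevalC.
- rewrite (_ : (fun x => _) = fun x : 'rV[K]_n.+1 => x 0 i); first exact: differentiable_coord.
  by apply/funext => y; rewrite mevalXU.
- rewrite (_ : (fun x => _) = (fun x : 'rV[K]_n.+1 => p.@[x 0]) + (fun x => q.@[x 0])).
    exact: differentiableD.
  by apply/funext => y; rewrite mevalD.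
- rewrite (_ : (fun x => _) = (fun x : 'rV[K]_n.+1 => p.@[x 0]) * (fun x => q.@[x 0])).
    exact: differentiableM.
  by apply/funext => y; rewrite mevalM.
Qed.

Lemma differentiable_rV m n (F : 'rV[K]_m.+1 -> 'rV[K]_n) x :
  (forall j, differentiable (fun x => F x 0 j) x) -> differentiable F x.
Proof.
move=> dF; rewrite (_ : F = \sum_(j < n) (fun x => F x 0 j *: delta_mx 0 j)); last first.
  by apply/funext => y; rewrite fct_sumE -row_sum_delta.
by apply: differentiable_sum => j; exact: differentiableZl.
Qed.

Lemma polynomial_holomorphic m n (F : 'rV[K]_m.+1 -> 'rV[K]_n) :
  polynomial_map F -> holomorphic_map F.
Proof.
move=> [P HP] x; apply: differentiable_rV => j.
rewrite (_ : (fun x => _) = (fun x : 'rV[K]_m.+1 => (P j).@[x 0])); first exact: differentiable_meval.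
by apply/funext => y; rewrite HP.
Qed.

Lemma algebraic_holomorphic n (phi : 'rV[K]_n.+1 -> 'rV[K]_n.+1) :
  algebraic_automorphism phi -> holomorphic_automorphism phi.
Proof. by move=> [psi [? ? ? ?]]; exists psi; split => //; exact: polynomial_holomorphic. Qed.
End PolynomialMaps.

(** * Extensions of the action *)

Section Coordinates.
Variable K : comNzRingType.
Implicit Types b s x y z : K.

(* [af], [f0], [vf], [ff], [sv] are [a], [f0], [v], [f], [s]; [ff] is a function of [b] and [s]. *)
Definition af b := b * (b - 1).
Definition f0 b := 1 + b * af b ^+ 10.
Definition vf b x y z := f0 b * y - x * z.
Definition ff b s := 1 + b * (af b * (1 + af b * s)) ^+ 10.

Definition ib : 'I_5 := @Ordinal 5 0 isT.
Definition ix : 'I_5 := @Ordinal 5 1 isT.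
Definition iy : 'I_5 := @Ordinal 5 2 isT.
Definition iz : 'I_5 := @Ordinal 5 3 isT.
Definition iu : 'I_5 := @Ordinal 5 4 isT.

Definition sv (p : 'rV[K]_5) : K := p 0 ix * vf (p 0 ib) (p 0 ix) (p 0 iy) (p 0 iz).

Definition vec (b x y z u : K) : 'rV[K]_5 := \row_j nth 0 [:: b; x; y; z; u] j.
End Coordinates.

Lemma af_morph (K L : comNzRingType) (f : {rmorphism K -> L}) b : f (af b) = af (f b).
Proof. by rewrite /af rmorphM rmorphB rmorph1. Qed.

Lemma f0_morph (K L : comNzRingType) (f : {rmorphism K -> L}) b : f (f0 b) = f0 (f b).
Proof. by rewrite /f0 rmorphD rmorphM rmorphXn rmorph1 af_morph. Qed.

Lemma vf_morph (K L : comNzRingType) (f : {rmorphism K -> L}) b x y z :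
  f (vf b x y z) = vf (f b) (f x) (f y) (f z).
Proof. by rewrite /vf rmorphB !rmorphM f0_morph. Qed.

Lemma ff_morph (K L : comNzRingType) (f : {rmorphism K -> L}) b s : f (ff b s) = ff (f b) (f s).
Proof. by rewrite /ff rmorphD rmorphM rmorphXn rmorphM rmorphD rmorphM !rmorph1 af_morph. Qed.

(** * Critical points of [s] on the slices of constant [b] *)

Section CriticalPoints.
Variable K : numClosedFieldType.
Local Notation V := 'rV[K]_5.
Implicit Types (p q : V) (F G : V -> V).

Lemma line_coord p (i j : 'I_5) (t : K) : (p + t *: delta_mx 0 i) 0 j = p 0 j + t *+ (j == i).
Proof. by rewrite !mxE eqxx /= mulr_natr. Qed.

Lemma differentiable_sv p : differentiable (sv (K := K)) p.
Proof.
pose sP : {mpoly K[5]} := 'X_ix * vf 'X_ib 'X_ix 'X_iy 'X_iz.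
rewrite (_ : sv (K := K) = fun p : V => sP.@[p 0]); first exact: differentiable_meval.
by apply/funext => q; rewrite /sP /sv mevalM (vf_morph (meval _)) /= !mevalXU.
Qed.

Lemma diff_sv_z p : 'd (sv (K := K)) p (delta_mx 0 iz) = - p 0 ix ^+ 2.
Proof.
have df t := differentiable_sv (p + t *: delta_mx 0 iz).
have := cder_line (df 0); rewrite scale0r addr0 => h; rewrite -(cderD1 h); apply: cderD1.
pose c := f0 (p 0 ib) * p 0 iy - p 0 ix * p 0 iz.
have := cderD (cder_cst (p 0 ix * c) 0) (cderM (cder_cst (- p 0 ix ^+ 2) 0) (cder_id 0)).
rewrite mul0r add0r add0r mulr1; apply: cder_ext => t.
by rewrite /sv /vf /c !line_coord /= !mulr0n !addr0 mulr1n; ring.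
Qed.

Lemma diff_sv_x p : p 0 ix = 0 -> 'd (sv (K := K)) p (delta_mx 0 ix) = f0 (p 0 ib) * p 0 iy.
Proof.
move=> x0; have df t := differentiable_sv (p + t *: delta_mx 0 ix).
have := cder_line (df 0); rewrite scale0r addr0 => h; rewrite -(cderD1 h); apply: cderD1.
have := cderM (cder_id 0) (cderB (cder_cst (f0 (p 0 ib) * p 0 iy) 0) (cderM (cder_id 0) (cder_cst (p 0 iz) 0))).
rewrite !mul0r subr0 addr0 mul1r; apply: cder_ext => t.
by rewrite /sv /vf !line_coord /= !mulr0n !addr0 mulr1n x0 add0r.
Qed.

Lemma iz_neq : (delta_mx 0 iz : V) 0 ib = 0. Proof. by rewrite mxE. Qed.
Lemma ix_neq : (delta_mx 0 ix : V) 0 ib = 0. Proof. by rewrite mxE. Qed.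

Section Inverse.
Variables (F G : V -> V) (p : V).
Hypotheses (FK : cancel F G) (GK : cancel G F).
Hypotheses (dF : holomorphic_map F) (dG : holomorphic_map G).
Hypothesis Fb : forall i t, i != ib -> F (p + t *: delta_mx 0 i) 0 ib = F p 0 ib.

Let transfer (h : V -> K) : differentiable h (F p) ->
  (forall i t, i != ib -> h (F (p + t *: delta_mx 0 i)) = h (F p)) ->
  forall e : V, e 0 ib = 0 -> 'd h (F p) e = 0.
Proof.
move=> dh Hh; apply: (tangent_transfer FK GK) => //.
- have dhF : differentiable (fun x => h (F x)) p by exact: (@differentiable_comp _ _ _ _ F h).
  by apply: diff_delta => // i ni; apply: diff_line_cst => // t; exact: Hh.
- have dFb : differentiable (fun x => F x 0 ib) p by exact: differentiable_coord0.
  by apply: diff_delta => // i ni; apply: diff_line_cst => // t; exact: Fb.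
Qed.

(** By [tangent_transfer] the differential of [s] at [F p] vanishes on the vectors tangent to the
    slice. Its [z]-component is [- x ^+ 2], and once [x = 0] its [x]-component is [f0 * y]. *)
Lemma critical_sv : (forall i t, i != ib -> sv (F (p + t *: delta_mx 0 i)) = sv (F p)) ->
  F p 0 ix = 0 /\ f0 (F p 0 ib) * F p 0 iy = 0.
Proof.
move=> Hs; have T := transfer (differentiable_sv _) Hs.
have x0 : F p 0 ix = 0.
  have := T _ iz_neq; rewrite diff_sv_z => /eqP.
  by rewrite oppr_eq0 expf_eq0 /= => /eqP.
by split => //; rewrite -diff_sv_x// T// ix_neq.
Qed.

(** Otherwise the differential of the coordinate [x] would vanish on the slice, against its value
    [1] on the [x]-direction. *)
Lemma not_all_x_cst : (forall i t, i != ib -> F (p + t *: delta_mx 0 i) 0 ix = F p 0 ix) -> False.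
Proof.
move=> Hx; have T := transfer (differentiable_coord _ 0 ix) Hx.
by have := T _ ix_neq; rewrite diff_coord mxE !eqxx => /eqP; rewrite oner_eq0.
Qed.
End Inverse.

Lemma line_entire F p w j : holomorphic_map F -> forall t : K, exists d, cder (fun t => F (p + t *: w) 0 j) t d.
Proof.
move=> dF t; eexists; apply: (cder_line (f := fun x => F x 0 j)).
exact: differentiable_coord0.
Qed.
End CriticalPoints.

(** * Holomorphic automorphisms that preserve the hypersurface *)

Section Rigidity.
Variable R : realType.
Local Notation C := R[i].
Local Notation V := 'rV[C]_5.
Implicit Types (B S : C -> C) (p q : V) (F G : V -> V).

(** The [size P] distinct points [c + r / (k + 2)] cannot all be roots. *)
Lemma poly_nonroot_near (P : {poly C}) (c : C) (r : R) : P != 0 -> 0 < r ->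
  exists2 t : C, normc t < r & P.[c + t] != 0.
Proof.
move=> P0 r0; apply: contrapT => H.
pose x (k : nat) : R := r / k.+2%:R.
have xI : injective x.
  by move=> k l /(mulfI (lt0r_neq0 r0))/invr_inj/eqP; rewrite eqr_nat => /eqP[].
pose rs := [seq c + (x k)%:C | k <- iota 0 (size P)].
have urs : uniq rs.
  by rewrite map_inj_uniq ?iota_uniq// => k l /addrI[]/xI.
have rrs : all (root P) rs.
  apply/allP => _ /mapP[k _ ->]; apply/negPn/negP => nr; apply: H; exists (x k)%:C => //.
  rewrite normc_real ger0_norm; last by rewrite divr_ge0// ltW.
  by rewrite ltr_pdivrMr ?ltr0n// ltr_pMr// ltr1n.
by have := max_poly_roots P0 rrs urs; rewrite size_map size_iota ltnn.
Qed.

Lemma entire_af B : entire B -> entire (fun z => af (B z)).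
Proof. by move=> eB; apply: entireM => //; apply: entireB => //; exact: entire_cst. Qed.

(** Differentiating [B ^+ 2 = B] gives [(2 * B - 1) * cD B = 0], where the first factor is [1] or
    [-1]. *)
Lemma entire_idem B : entire B -> (forall z, B z = 0 \/ B z = 1) -> forall z w, B z = B w.
Proof.
move=> eB B01; apply: cD_eq0_cst => // z.
have dB := entireD1 z eB.
have := cderB (cderM dB dB) dB.
have B2 w : B w * B w - B w = 0 by case: (B01 w) => ->; ring.
have h : cder (fun w => B w * B w - B w) z 0 by apply: (cder_ext (E := fun=> 0)) (cder_cst 0 z) => w; rewrite B2.
move=> /cderD1; rewrite (cderD1 h) => e.
have : (2%:R * B z - 1) * cD B z = 0 by rewrite e; ring.
move=> /eqP; rewrite mulf_eq0 => /orP[|/eqP//].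
case: (B01 z) => ->; rewrite ?mulr0 ?mulr1 ?sub0r ?oppr_eq0 ?oner_eq0//.
by rewrite (_ : 2%:R - 1 = 1 :> C) ?oner_eq0//; ring.
Qed.

Lemma ff_avoid_cst B S : entire B -> entire S -> (forall z, ff (B z) (S z) != 0) ->
  forall z w, B z = B w.
Proof.
move=> eB eS H.
have n10 : (1 : C) != 0 by exact: oner_neq0.
have omit : (forall z, B z != 0) -> (forall z, B z != 1) -> forall z w, B z = B w.
  by move=> h0 h1; apply: (picard_omit2 eB (a := 0) (b := 1)) => //; rewrite eq_sym.
pose Om z := 1 + af (B z) * S z.
have eOm : entire Om.
  by apply: entireD; [exact: entire_cst|apply: entireM => //; exact: entire_af].
pose W z := (B z - 1) * Om z.
have eW : entire W by apply: entireM => //; apply: entireB => //; exact: entire_cst.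
have ffE z : ff (B z) (S z) = 1 + B z ^+ 11 * W z ^+ 10.
  by rewrite /ff -/(Om z) /W /af !exprMn (exprS _ 10); ring.
have cst := picard_power eB eW (fun z => eq_ind _ (fun u => u != 0) (H z) _ (ffE z)).
(* If the constant is not [0], then [B] omits [0] and [1]. If it is [0], then at each point [B] is
   [0] or [1], with [Om = 1], or else [Om = 0]; so [Om] is constant, and [B] omits both values or
   takes only these two. *)
have [c0|c0] := eqVneq (B 0 ^+ 11 * W 0 ^+ 10) 0; last first.
  have nz z : B z ^+ 11 * W z ^+ 10 != 0 by rewrite (cst z 0).
  apply: omit => z; have := nz z; apply: contraNneq => Bz; rewrite /W Bz.
    by rewrite expr0n mul0r.
  by rewrite subrr mul0r expr0n mulr0.
have zero z : B z = 0 \/ B z = 1 \/ Om z = 0.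
  have /eqP := cst z 0; rewrite c0 mulf_eq0 !expf_eq0 /= /W mulf_eq0 subr_eq0.
  by case/orP => [/eqP|/orP[/eqP|/eqP]]; auto.
have B01 z : B z = 0 \/ B z = 1 -> Om z = 1.
  by rewrite /Om /af => -[] ->; ring.
have Om01 z : Om z = 0 \/ Om z = 1.
  by case: (zero z) => [h|[h|h]]; [right; apply: B01; left|right; apply: B01; right|left].
have Ocst := entire_idem eOm Om01.
case: (Om01 0) => O0.
  apply: omit => z; apply/eqP => Bz.
    by have := B01 z (or_introl Bz); rewrite (Ocst z 0) O0 => /esym/eqP; rewrite (negbTE n10).
  by have := B01 z (or_intror Bz); rewrite (Ocst z 0) O0 => /esym/eqP; rewrite (negbTE n10).
apply: entire_idem => // z; case: (zero z) => [|[|]]; auto.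
by rewrite (Ocst z 0) O0 => /eqP; rewrite (negbTE n10).
Qed.

Lemma ff_root2 (c : C) : c != 0 -> c != 1 ->
  exists s1 s2 : C, [/\ s1 != s2, ff c s1 = 0 & ff c s2 = 0].
Proof.
move=> c0 c1; pose a := af c.
have a0 : a != 0 by rewrite mulf_neq0// subr_eq0.
(* [ff c s = 0] means that [a * (1 + a * s)] is a tenth root of [- c^-1]; [r] and [- r] are two of
   them. *)
pose r := 10.-root (- c^-1).
have r10 : r ^+ 10 = - c^-1 by rewrite rootCK.
have rn : r != 0.
  by apply/eqP => r0; move: r10; rewrite r0 expr0n => /esym/eqP; rewrite oppr_eq0 invr_eq0 (negbTE c0).
have h u : u ^+ 10 = - c^-1 -> ff c ((u / a - 1) / a) = 0.
  move=> u10; rewrite /ff -/a; have -> : a * (1 + a * ((u / a - 1) / a)) = u by field.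
  by rewrite u10 mulrN divff// subrr.
exists ((r / a - 1) / a), ((- r / a - 1) / a); split; [|exact: h|apply: h].
  apply/eqP => /(divIf a0)/addIr/(divIf a0)/eqP.
  by rewrite -subr_eq0 opprK -mulr2n mulrn_eq0 /= (negbTE rn).
by rewrite exprNn r10 -signr_odd expr0 mul1r.
Qed.

Section Extension.
Variables (F G : V -> V).
Hypotheses (FK : cancel F G) (GK : cancel G F).
Hypotheses (dF : holomorphic_map F) (dG : holomorphic_map G).
Hypothesis GH : forall p, ff (p 0 ib) (sv p) = 0 -> ff (G p 0 ib) (sv (G p)) = 0.

Let F_avoid p : ff (p 0 ib) (sv p) != 0 -> ff (F p 0 ib) (sv (F p)) != 0.
Proof. by apply: contra_neq => /GH; rewrite FK. Qed.

Let line_e p w j : entire (fun t => F (p + t *: w) 0 j).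
Proof. exact: line_entire. Qed.

Lemma line_sv p w : entire (fun t => sv (F (p + t *: w))).
Proof.
rewrite /sv /vf /f0; apply: entireM => //; apply: entireB; apply: entireM => //.
apply: entireD; first exact: entire_cst.
by apply: entireM => //; apply: entireX; exact: entire_af.
Qed.

Let lineE p q : p + 1 *: (q - p) = q.
Proof. by rewrite scale1r addrC subrK. Qed.

Let line0E p w : p + 0 *: w = p.
Proof. by rewrite scale0r addr0. Qed.

Let delta_b p (i : 'I_5) (t : C) : i != ib -> (p + t *: delta_mx 0 i) 0 ib = p 0 ib.
Proof. by rewrite line_coord eq_sym => /negbTE ->; rewrite addr0. Qed.

(** [ff] is [1] on both slices [b = 0] and [b = 1], so the line through [p] and [q] avoids the
    hypersurface and [ff_avoid_cst] applies to its image. *)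
Lemma special_b p q (c := p 0 ib) : c = 0 \/ c = 1 -> q 0 ib = c -> F q 0 ib = F p 0 ib.
Proof.
move=> c01 qc.
have := ff_avoid_cst (line_e p (q - p) ib) (line_sv p (q - p)).
move=> /(_ _ 1 0); rewrite lineE line0E; apply => t; apply: F_avoid.
have -> : (p + t *: (q - p)) 0 ib = c by rewrite !mxE qc subrr mulr0 addr0.
rewrite /ff /af; case: c01 => ->; first by rewrite mul0r addr0 oner_neq0.
by rewrite subrr mulr0 mul0r expr0n mulr0 addr0 oner_neq0.
Qed.

Lemma special_b01 p : p 0 ib = 0 \/ p 0 ib = 1 -> F p 0 ib = 0 \/ F p 0 ib = 1.
Proof.
move=> c01; pose be := F p 0 ib.
have [b0|b0] := eqVneq be 0; first by left.
have [b1|b1] := eqVneq be 1; first by right.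
exfalso; have [s1 [s2 [s12 r1 r2]]] := ff_root2 b0 b1.
have Fb q : q 0 ib = p 0 ib -> F q 0 ib = be by exact: special_b.
have c01' q : q 0 ib = p 0 ib -> q 0 ib = 0 \/ q 0 ib = 1 by move=> ->.
have avoid q : q 0 ib = p 0 ib -> ff be (sv (F q)) != 0.
  move=> qp; rewrite -(Fb q qp); apply: F_avoid; rewrite /ff /af.
  case: (c01' q qp) => ->; first by rewrite mul0r addr0 oner_neq0.
  by rewrite subrr mulr0 mul0r expr0n mulr0 addr0 oner_neq0.
(* On the slice, [s] after [F] omits the two roots [s1] and [s2]. Being constant, it makes every
   image point critical for [s], hence of coordinate [x = 0]. *)
have sF q q' : q 0 ib = p 0 ib -> q' 0 ib = p 0 ib -> sv (F q') = sv (F q).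
  move=> qp qp'.
  have lb t : (q + t *: (q' - q)) 0 ib = p 0 ib by rewrite !mxE qp qp' subrr mulr0 addr0.
  have := picard_omit2 (line_sv q (q' - q)) s12.
  move=> /(_ _ _ 1 0); rewrite lineE line0E; apply => t; have := avoid _ (lb t).
    by apply: contraNneq => ->; rewrite r1.
  by apply: contraNneq => ->; rewrite r2.
have x0 q : q 0 ib = p 0 ib -> F q 0 ix = 0.
  move=> qp; have [] // := @critical_sv _ F G q FK GK dF dG.
    by move=> i t ni; rewrite !Fb// delta_b.
  by move=> i t ni; apply: sF; rewrite ?delta_b.
apply: (@not_all_x_cst _ F G p FK GK dF dG).
  by move=> i t ni; rewrite !Fb// delta_b.
by move=> i t ni; rewrite !x0// delta_b.
Qed.
End Extension.

Theorem rigidity F G : cancel F G -> cancel G F -> holomorphic_map F -> holomorphic_map G ->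
  (forall p, ff (p 0 ib) (sv p) = 0 -> ff (G p 0 ib) (sv (G p)) = 0) ->
  (forall p, ff (p 0 ib) (sv p) = 0 -> ff (F p 0 ib) (sv (F p)) = 0 /\ F p 0 ib = p 0 ib) ->
  forall c : C, f0 c = 0 -> F (vec c 0 0 0 0) 0 iy = 0.
Proof.
move=> FK GK dF dG GH FH.
have F01 := special_b01 FK GK dF dG GH.
have G01 := special_b01 GK FK dG dF (fun p h => (FH p h).1).
have Fb p : p 0 ib != 0 -> p 0 ib != 1 -> F p 0 ib = p 0 ib.
  move=> b0 b1; pose c := p 0 ib.
  have nF q : q 0 ib = c -> F q 0 ib != 0 /\ F q 0 ib != 1.
    move=> qc; split; apply/eqP => h.
      by case: (G01 (F q) (or_introl h)); rewrite FK qc => /eqP; rewrite ?(negbTE b0) ?(negbTE b1).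
    by case: (G01 (F q) (or_intror h)); rewrite FK qc => /eqP; rewrite ?(negbTE b0) ?(negbTE b1).
  have [s [_ [_ sr _]]] := ff_root2 b0 b1.
  (* A point of the slice with [sv q = s], hence on the hypersurface, where [F] fixes [b]. *)
  pose q : V := vec c 1 0 (- s) 0.
  have qb : q 0 ib = c by rewrite mxE.
  have qs : sv q = s by rewrite /sv /vf !mxE /=; ring.
  have [|_ Fq] := FH q; first by rewrite qb qs.
  rewrite -/c -[in RHS]qb -Fq.
  have lb t : (q + t *: (p - q)) 0 ib = c.
    by rewrite !mxE /= -/c subrr mulr0 addr0.
  have := picard_omit2 (line_entire q (p - q) ib dF) (a := 0) (b := 1).
  rewrite eq_sym oner_neq0 => /(_ isT) h.
  have := h (fun t => (nF _ (lb t)).1) (fun t => (nF _ (lb t)).2) 1 0.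
  by rewrite scale1r scale0r addr0 addrC subrK.
have key c : f0 c != 0 -> c != 0 -> c != 1 -> F (vec c 0 0 0 0) 0 iy = 0.
  move=> fc c0 c1; pose p : V := vec c 0 0 0 0.
  have pb : p 0 ib = c by rewrite mxE.
  have lb i t : i != ib -> (p + t *: delta_mx 0 i) 0 ib = c.
    by rewrite line_coord pb eq_sym => /negbTE ->; rewrite addr0.
  have Fl i t : i != ib -> F (p + t *: delta_mx 0 i) 0 ib = c.
    by move=> ni; rewrite Fb lb.
  have Fp : F p 0 ib = c by rewrite Fb pb.
  (* Along each coordinate line only one of [x], [y], [z] can be nonzero, so both terms of [s]
     vanish and [ff] is [f0 c] there. *)
  have ls i t : i != ib -> sv (p + t *: delta_mx 0 i) = 0.
    move=> ni; rewrite /sv !line_coord !mxE /= !add0r.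
    case: i ni => -[|[|[|[|[|i]]]]] //= Hi _; rewrite ?mulr0n ?mulr1n ?mul0r// /vf; ring.
  have [s1 [s2 [s12 r1 r2]]] := ff_root2 c0 c1.
  have av i t : i != ib -> ff c (sv (F (p + t *: delta_mx 0 i))) != 0.
    move=> ni; rewrite -{1}(Fl i t ni); apply/eqP => /GH; rewrite FK ls// lb//.
    by rewrite /ff mulr0 addr0 mulr1 => /eqP; rewrite -/(f0 c) (negbTE fc).
  have sc i t : i != ib -> sv (F (p + t *: delta_mx 0 i)) = sv (F p).
    move=> ni; have eS := line_sv dF p (delta_mx 0 i).
    have := picard_omit2 eS s12 _ _ t 0; rewrite scale0r addr0; apply => u.
      by have := av i u ni; apply: contraNneq => ->; rewrite r1.
    by have := av i u ni; apply: contraNneq => ->; rewrite r2.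
  have [_] := critical_sv FK GK dF dG (fun i t ni => etrans (Fl i t ni) (esym Fp)) sc.
  by move=> /eqP; rewrite Fp mulf_eq0 (negbTE fc) => /eqP.
move=> c fc; apply/eqP/negP => /negP Y0.
pose Y t := F (vec c 0 0 0 0 + t *: delta_mx 0 ib) 0 iy.
have eY : entire Y by exact: line_entire.
have YE t : Y t = F (vec (c + t) 0 0 0 0) 0 iy.
  congr (F _ 0 iy); apply/rowP => j; rewrite !mxE eqxx /=.
  by case: j => -[|[|[|[|[|j]]]]] //= Hj; rewrite ?mulr1 ?mulr0 ?addr0.
have [d dY] := eY 0.
have nY : 0 < normc (Y 0) / 2 by rewrite divr_gt0// normc_gt0 YE addr0.
have [r r0 hr] := cder_ccont dY nY.
(* Its non-roots are the values to which [key] applies, and they accumulate at [c]; continuity of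
   [Y] then contradicts [Y 0 <> 0]. *)
pose P : {poly C} := f0 'X * 'X * ('X - 1).
have P0 : P != 0.
  rewrite !mulf_neq0 ?polyX_eq0 ?polyXsubC_eq0//.
  by apply/eqP => /(congr1 (fun u : {poly C} => u.[0])); rewrite /f0 !hornerE => /eqP; rewrite oner_eq0.
have [t tr] := poly_nonroot_near c P0 r0.
have f0t : (f0 ('X : {poly C})).[c + t] = f0 (c + t).
  by have := f0_morph (horner_eval (c + t)) 'X; rewrite /= /horner_eval hornerX.
rewrite /P !hornerM f0t hornerX hornerD hornerX hornerN hornerC.
rewrite !mulf_eq0 subr_eq0 => /norP[/norP[h1 h2] h3].
have := hr t tr; rewrite add0r YE key// sub0r normcN.
by have : 0 < normc (Y 0); [rewrite normc_gt0 YE addr0|lra].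
Qed.
End Rigidity.

(** * Smoothness and irreducibility *)

Section Polynomials.
Variables (K : numClosedFieldType) (n : nat).
Local Notation V := 'rV[K]_n.+1.
Implicit Types (p q : {mpoly K[n.+1]}) (x : V) (i j : 'I_n.+1).

Lemma mderivXU i j : ('X_j : {mpoly K[n.+1]})^`M(i) = (i == j)%:R.
Proof.
rewrite mderivX mnm1E eq_sym; case: eqP => [->|_]; last by rewrite scale0r.
by rewrite scale1r -{1}(addm0 U_(j)%MM) addmC addmK mpolyX0.
Qed.

Lemma cder_meval p x i : cder (fun t : K => p.@[(x + t *: delta_mx 0 i) 0]) 0 (p^`M(i)).@[x 0].
Proof.
have x0 : x + (0 : K) *: delta_mx 0 i = x by rewrite scale0r addr0.
elim/mpoly_ring_ind: p => [a|j|p q IHp IHq|p q IHp IHq].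
- by rewrite mderivC meval0; apply: (cder_ext (E := fun=> a)) (cder_cst _ _) => t; rewrite mevalC.
- rewrite mderivXU raddfMn /= meval1.
  have := cderD (cder_cst (x 0 j) 0) (cderM (cder_id 0) (cder_cst ((i == j)%:R : K) 0)).
  rewrite add0r mul1r mul0r addr0; apply: cder_ext => t.
  by rewrite mevalXU !mxE eqxx /= eq_sym.
- have := cderD IHp IHq; rewrite mderivD mevalD; apply: cder_ext => t; by rewrite mevalD.
- have := cderM IHp IHq; rewrite x0 mderivM mevalD !mevalM; apply: cder_ext => t.
  by rewrite mevalM.
Qed.

Lemma meval_at0 p : p.@[fun=> 0] = p@_0.
Proof.
elim/mpolyind: p => [|a m p _ _ IH]; first by rewrite meval0 mcoeff0.
rewrite mevalD mevalZ IH mcoeffD mcoeffZ mcoeffX mevalX; congr (_ * _ + _).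
have [->|m0] := eqVneq m 0%MM; first by rewrite big1// => i _; rewrite mnm0E expr0.
have [i mi] : exists i, m i != 0%N.
  apply/existsP; apply: contraNT m0 => /existsPn H; apply/eqP/mnmP => i.
  by rewrite mnm0E; apply/eqP; have := H i; rewrite negbK.
by rewrite (bigD1 i)//= expr0n (negbTE mi) mul0r.
Qed.

(** The partial derivatives also vanish everywhere. By induction on the degree of [m], its
    coefficient is, up to a nonzero integer factor, a coefficient of a derivative. *)
Lemma meval_eq0 p : (forall x, p.@[x 0] = 0) -> p = 0.
Proof.
move=> p0; apply/mpolyP => m; rewrite mcoeff0.
have [k mk] := ubnP (mdeg m); elim: k => // k IH in p p0 m mk *.
have [->|m0] := eqVneq m 0%MM.
  by rewrite -meval_at0 -(p0 0); apply: meval_eq => i; rewrite mxE.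
have [i mi] : exists i, m i != 0%N.
  apply/existsP; apply: contraNT m0 => /existsPn H; apply/eqP/mnmP => i.
  by rewrite mnm0E; apply/eqP; have := H i; rewrite negbK.
have mE : m = (m - U_(i) + U_(i))%MM by rewrite submK// lep1mP.
have d0 x : (p^`M(i)).@[x 0] = 0.
  have := cder_meval p x i => /cderD1 <-; apply: cderD1.
  by apply: cder_ext (cder_cst 0 0) => t; rewrite p0.
have lt : (mdeg (m - U_(i)) < k)%N.
  by move: mk; rewrite {1}mE mdegD mdeg1 addn1 ltnS.
have := IH _ d0 _ lt; rewrite mcoeff_deriv -mE => /eqP.
by rewrite mulrn_eq0 /= => /eqP.
Qed.

Lemma mpoly_unit_nonvanishing p : (forall x, p.@[x 0] != 0) ->
  (forall x, p.@[x 0] = p.@[(0 : V) 0]) -> p \is a GRing.unit.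
Proof.
move=> p0 pc; have := meval_eq0 (p := p - (p.@[(0 : V) 0])%:MP) => H.
have /subr0_eq -> : p - (p.@[(0 : V) 0])%:MP = 0.
  by apply: H => x; rewrite mevalB mevalC pc subrr.
have nz := p0 0; apply/unitrP; exists ((p.@[(0 : V) 0])^-1)%:MP.
by rewrite -!mpolyCM mulVf// mulfV.
Qed.
End Polynomials.

(** * Smoothness of the hypersurface *)

Section Hypersurface.
Variable K : numClosedFieldType.
Local Notation V := 'rV[K]_5.
Implicit Types (p q : V) (g h : {mpoly K[5]}).

Definition fpoly : {mpoly K[5]} := ff 'X_ib ('X_ix * vf 'X_ib 'X_ix 'X_iy 'X_iz).

Lemma fpolyE p : fpoly.@[p 0] = ff (p 0 ib) (sv p).
Proof. by rewrite /fpoly (ff_morph (meval _)) /= mevalM (vf_morph (meval _)) /= !mevalXU. Qed.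

(** The expression is the derivative of [f0], so the roots of [f0] are simple. Besides the roots of
    [b * af b], where [f0] is [1], the only critical point is [11 / 21], where [f0] is positive
    because the power is even. *)
Lemma f0_critical (b : K) : f0 b = 0 -> af b ^+ 9 * b * (21%:R * b - 11%:R) != 0.
Proof.
move=> fb; have a0 : af b != 0.
  by apply: contra_eq_neq fb => a0; rewrite /f0 a0 expr0n mulr0 addr0 oner_neq0.
have b0 : b != 0 by apply: contraNneq a0 => ->; rewrite /af mul0r.
rewrite mulf_neq0 ?(mulf_neq0 (expf_neq0 9 a0) b0)//; apply: contra_eq_neq fb => /eqP.
rewrite subr_eq0 => /eqP b11; have -> : b = 11%:R / 21%:R.
  have n21 : (21%:R : K) != 0 by rewrite pnatr_eq0.
    by apply: (canRL (mulfK n21)); rewrite mulrC.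
have -> : f0 (11%:R / 21%:R : K) = 1 + 11%:R / 21%:R * (110%:R / 441%:R) ^+ 10.
  have -> : f0 (11%:R / 21%:R : K) = 1 + 11%:R / 21%:R * (- (110%:R / 441%:R)) ^+ 10.
    by rewrite /f0; congr (1 + _ * _ ^+ 10); rewrite /af; field; rewrite ?pnatr_eq0.
  by rewrite exprNn -signr_odd expr0 mul1r.
apply: lt0r_neq0; apply: ltr_wpDr ltr01; apply: mulr_ge0; [|apply: exprn_ge0];
  by apply: divr_ge0; exact: ler0n.
Qed.

(** Where [x = 0] the polynomial reduces to [f0] along the [b]-line, whose roots are simple. Where
    [x <> 0] the [z]-derivative is a product of factors that cannot vanish on the hypersurface. *)
Lemma fpoly_smooth p : fpoly.@[p 0] = 0 -> exists i, (fpoly^`M(i)).@[p 0] != 0.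
Proof.
rewrite fpolyE => Hp; set b := p 0 ib in Hp.
have Tn : af b * (1 + af b * sv p) != 0.
  by apply: contra_eq_neq Hp => T0; rewrite /ff T0 expr0n mulr0 addr0 oner_neq0.
have := Tn; rewrite mulf_eq0 => /norP[a0 _].
have b0 : b != 0 by apply: contraNneq a0 => ->; rewrite /af mul0r.
have [x0|x0] := eqVneq (p 0 ix) 0.
  exists ib; have f0b : f0 b = 0.
    by rewrite -Hp /sv x0 mul0r /ff mulr0 addr0 mulr1.
  have := f0_critical f0b; apply: contraNneq => d0.
  have := cder_meval fpoly p ib; rewrite d0 => h; apply/eqP; apply: etrans (cderD1 h); apply/esym/cderD1.
  pose B (t : K) := b + t; have cB : cder B 0 1.
    by have := cderD (cder_cst b 0) (cder_id 0); rewrite add0r.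
  have := cderD (cder_cst 1 0) (cderM cB (cderX 9 (cderM cB (cderB cB (cder_cst 1 0))))).
  rewrite /B addr0 (_ : 0 + _ = af b ^+ 9 * b * (21%:R * b - 11%:R)); last first.
    by rewrite /af (exprS _ 9); ring.
  apply: cder_ext => t; rewrite fpolyE /sv !line_coord /= mulr0n mulr1n addr0 x0 mul0r.
  by rewrite /ff mulr0 addr0 mulr1.
exists iz; set T := af b * _ in Tn.
have : - (10%:R * b * T ^+ 9 * af b ^+ 2 * p 0 ix ^+ 2) != 0.
  rewrite oppr_eq0; apply: mulf_neq0 (expf_neq0 2 x0); apply: mulf_neq0 (expf_neq0 2 a0).
  by apply: mulf_neq0 (expf_neq0 9 Tn); apply: mulf_neq0 b0; rewrite pnatr_eq0.
apply: contraNneq => d0.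
have := cder_meval fpoly p iz; rewrite d0 => h; apply/eqP; apply: etrans (cderD1 h); apply/esym/cderD1.
pose S (t : K) := p 0 ix * (f0 b * p 0 iy - p 0 ix * (p 0 iz + t)).
have cS : cder S 0 (- p 0 ix ^+ 2).
  have := cderM (cder_cst (p 0 ix) 0) (cderB (cder_cst (f0 b * p 0 iy) 0)
    (cderM (cder_cst (p 0 ix) 0) (cderD (cder_cst (p 0 iz) 0) (cder_id 0)))).
  by congr (cder _ _ _); ring.
have c1 := cder_cst (1 : K) 0; have ca := cder_cst (af b) 0.
have := cderD c1 (cderM (cder_cst b 0) (cderX 9 (cderM ca (cderD c1 (cderM ca cS))))).
rewrite (_ : S 0 = sv p) -/T; last by rewrite /S addr0.
rewrite (_ : 0 + _ = - (10%:R * b * T ^+ 9 * af b ^+ 2 * p 0 ix ^+ 2)); last by ring.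
apply: cder_ext => t; rewrite fpolyE /sv !line_coord /= !mulr0n !addr0 mulr1n.
by rewrite /ff /vf /S.
Qed.
End Hypersurface.

(** * Substitution of univariate polynomials and fractions *)

Section Substitution.
Variables (K : closedFieldType) (n : nat).
Implicit Types (p : {mpoly K[n]}) (P Q D : {poly K}).

Lemma poly_eq0_of_horner P : (forall t, P.[t] = 0) -> P = 0.
Proof. by move=> H; apply/eqP/negPn/negP => /closed_nonrootP[t]; rewrite /root H eqxx. Qed.

Lemma poly_cst_of_nonroot P : (forall t, P.[t] != 0) -> forall s t, P.[s] = P.[t].
Proof.
move=> H s t; have /eqP/size_poly1P[c _ ->] : size P = 1%N; last by rewrite !hornerC.
by apply/eqP; apply: contraT => /closed_rootP[x /eqP]; move/eqP: (H x).
Qed.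

Lemma meval_horner p (h : 'I_n -> {poly K}) :
  exists Q, forall t, p.@[fun j => (h j).[t]] = Q.[t].
Proof.
elim/mpoly_ring_ind: p => [c|j|p q [P HP] [Q HQ]|p q [P HP] [Q HQ]].
- by exists c%:P => t; rewrite mevalC hornerC.
- by exists (h j) => t; rewrite mevalXU.
- by exists (P + Q) => t; rewrite mevalD hornerD HP HQ.
- by exists (P * Q) => t; rewrite mevalM hornerM HP HQ.
Qed.

Lemma meval_horner_frac p (h : 'I_n -> {poly K}) D :
  exists Q k, forall t, D.[t] != 0 -> p.@[fun j => (h j).[t] / D.[t]] * D.[t] ^+ k = Q.[t].
Proof.
elim/mpoly_ring_ind: p => [c|j|p q [P [k HP]] [Q [l HQ]]|p q [P [k HP]] [Q [l HQ]]].
- by exists c%:P, 0%N => t _; rewrite mevalC hornerC mulr1.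
- by exists (h j), 1%N => t D0; rewrite mevalXU divfK.
- exists (P * D ^+ l + Q * D ^+ k), (k + l)%N => t D0.
  by rewrite mevalD hornerD !hornerM !horner_exp -HP// -HQ// exprD; ring.
- exists (P * Q), (k + l)%N => t D0.
  by rewrite mevalM hornerM -HP// -HQ// exprD; ring.
Qed.
End Substitution.

(** * Irreducibility of the defining polynomial *)

Section Irreducible.
Variable K : numClosedFieldType.
Local Notation V := 'rV[K]_5.
Implicit Types (p q : V).

(** On each line through the origin the polynomial has no root over an algebraically closed field,
    hence it is constant. *)
Lemma mpoly_nonvanishing_unit n (g : {mpoly K[n.+1]}) :
  (forall x : 'rV[K]_n.+1, g.@[x 0] != 0) -> g \is a GRing.unit.
Proof.
move=> g0; apply: (mpoly_unit_nonvanishing g0) => x.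
have [Q HQ] := meval_horner g (fun j => (x 0 j)%:P * 'X).
have E t : Q.[t] = g.@[(t *: x) 0].
  by rewrite -HQ; apply: meval_eq => j; rewrite !hornerE mxE mulrC.
have := poly_cst_of_nonroot (P := Q) _ 1 0; rewrite !E scale1r scale0r; apply => t.
by rewrite E.
Qed.

Lemma f0_root : exists c : K, f0 c = 0.
Proof.
have /closed_rootP[c] : size (f0 ('X : {poly K})) != 1%N.
  apply/eqP => /eqP/size_poly1P[d _ fd].
  have E c : f0 c = d.
    by have := f0_morph (horner_eval c) 'X; rewrite /= /horner_eval hornerX fd hornerC.
  (* [f0] is not constant, as its values at [0] and [2] differ. *)
  have := E 0; rewrite -(E 2%:R) /f0 mul0r addr0 => /eqP.
  rewrite -subr_eq0 opprD addrA subrr sub0r oppr_eq0 /af.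
  rewrite (_ : 2%:R - 1 = 1 :> K); last by ring.
  by rewrite mulr1 mulf_eq0 expf_eq0 /= pnatr_eq0.
rewrite /root => /eqP fc; exists c.
by have := f0_morph (horner_eval c) 'X; rewrite /= /horner_eval hornerX fc.
Qed.

(* On [{f = 0, x != 0}], put [w = (a * (1 + a * s))^-1]: then [b = - w ^+ 10], and [z] is a rational
   function of [w], [x], [y], [u].  All coordinates are written over the denominator [para_den]. *)
Section Parametrization.
Variable L : comNzRingType.
Implicit Types w x y u : L.
Definition para_b w := - w ^+ 10.
Definition para_den w x := w * af (para_b w) ^+ 2 * x ^+ 2.
Definition para_num w x y u (j : 'I_5) :=
  let b := para_b w in let d := para_den w x in
  nth 0 [:: b * d; x * d; y * d; f0 b * y * x * w * af b ^+ 2 - (1 - w * af b); u * d] j.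
End Parametrization.

Lemma para_den_morph (L M : comNzRingType) (phi : {rmorphism L -> M}) w x :
  phi (para_den w x) = para_den (phi w) (phi x).
Proof. by rewrite /para_den /para_b 2!rmorphM !rmorphXn af_morph rmorphN rmorphXn. Qed.

Lemma para_num_morph (L M : comNzRingType) (phi : {rmorphism L -> M}) w x y u j :
  phi (para_num w x y u j) = para_num (phi w) (phi x) (phi y) (phi u) j.
Proof.
rewrite /para_num /para_den /para_b; case: j => -[|[|[|[|[|j]]]]] //= _;
 by rewrite !(rmorphM, rmorphB, rmorphN, rmorphXn, rmorph1, f0_morph, af_morph).
Qed.

Lemma para_zero (w x y u : K) : para_den w x != 0 ->
  (fpoly K).@[fun j => para_num w x y u j / para_den w x] = 0.
Proof.
move=> d0; pose p : V := \row_j (para_num w x y u j / para_den w x).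
rewrite (_ : _.@[_] = (fpoly K).@[p 0]); last by apply: meval_eq => j; rewrite mxE.
have w0 : w != 0 by apply: contraNneq d0 => ->; rewrite /para_den !mul0r.
have a0 : af (para_b w) != 0.
  by apply: contraNneq d0 => a0; rewrite /para_den a0 expr0n mulr0 mul0r.
have x0 : x != 0 by apply: contraNneq d0 => ->; rewrite /para_den expr0n mulr0.
rewrite fpolyE /sv /vf !mxE /para_num /= !mulfK//.
set z := _ / _; have T : af (para_b w) * (1 + af (para_b w) * (x * (f0 (para_b w) * y - x * z))) = w^-1.
  by rewrite /z /para_den; field; rewrite w0 a0 x0.
by rewrite /ff T /para_b exprVn mulNr divff ?subrr// expf_neq0.
Qed.

Lemma fpoly_para p : (fpoly K).@[p 0] = 0 -> p 0 ix != 0 ->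
  exists w, para_den w (p 0 ix) != 0 /\
    forall j, p 0 j = para_num w (p 0 ix) (p 0 iy) (p 0 iu) j / para_den w (p 0 ix).
Proof.
rewrite fpolyE => Hp x0; set b := p 0 ib in Hp; set a := af b.
set T := a * (1 + a * sv p); have bT : b * T ^+ 10 = - 1.
  by apply/eqP; rewrite -addr_eq0 addrC -/(ff b _) Hp.
have T0 : T != 0.
  by apply: contra_eq_neq bT => ->; rewrite expr0n mulr0 eq_sym oppr_eq0 oner_eq0.
have a0 : a != 0 by apply: contraNneq T0 => a0; rewrite /T a0 mul0r.
have bE : para_b T^-1 = b.
  by apply: (mulIf (expf_neq0 10 T0)); rewrite bT /para_b exprVn mulNr mulVf// expf_neq0.
have d0 : para_den T^-1 (p 0 ix) != 0.
  by rewrite /para_den bE -/a; apply: mulf_neq0 (expf_neq0 2 x0); apply: mulf_neq0 (expf_neq0 2 a0); rewrite invr_neq0.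
exists T^-1; split => // j; rewrite /para_num bE -/a.
have pE k (kj : (k < 5)%N) : p 0 (Ordinal kj) = nth 0 [:: b; p 0 ix; p 0 iy; p 0 iz; p 0 iu] k.
  by case: k kj => [|[|[|[|[|k]]]]] //= kj; congr (p 0 _); exact: val_inj.
case: j => j Hj; rewrite pE; case: j Hj => [|[|[|[|[|j]]]]] //= Hj; rewrite ?mulfK//.
apply: (canRL (mulfK d0)).
transitivity (f0 b * p 0 iy * p 0 ix * T^-1 * a ^+ 2 - (T^-1 * T - T^-1 * a)); last by rewrite mulVf.
by rewrite /para_den bE -/a; move: (T^-1) => ti; rewrite /T /sv /vf -/b; ring.
Qed.

Section Factorization.
Variables g h : {mpoly K[5]}.
Hypothesis gh : fpoly K = g * h.

(** By the Leibniz rule all partial derivatives of the product vanish at a common zero, against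
    smoothness. *)
Lemma factor_disjoint p : g.@[p 0] = 0 -> h.@[p 0] = 0 -> False.
Proof.
move=> g0 h0; have [|i] := fpoly_smooth (p := p); first by rewrite gh mevalM g0 mul0r.
by rewrite gh mderivM mevalD !mevalM g0 h0 ?(mulr0, mul0r) ?addr0 eqxx.
Qed.

(** The parameters of [p] and [q] are joined by a line. Along it the product of the factors
    vanishes, so, denominators cleared, [P * Q * D = 0]. But [h] is not [0] at [p] and [g] is not
    [0] at [q], so none of the three polynomials is zero. *)
Lemma factor_generic p q : p 0 ix != 0 -> q 0 ix != 0 -> g.@[p 0] = 0 -> h.@[q 0] = 0 -> False.
Proof.
move=> px qx gp hq.
have fp : (fpoly K).@[p 0] = 0 by rewrite gh mevalM gp mul0r.
have fq : (fpoly K).@[q 0] = 0 by rewrite gh mevalM hq mulr0.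
have [w [dp pE]] := fpoly_para fp px; have [w' [dq qE]] := fpoly_para fq qx.
pose l (c d : K) : {poly K} := c%:P + (d - c)%:P * 'X.
have l0 c d : (l c d).[0] = c by rewrite !(hornerD, hornerM, hornerC, hornerX) mulr0 addr0.
have l1 c d : (l c d).[1] = d by rewrite !(hornerD, hornerM, hornerC, hornerX) mulr1 addrC subrK.
pose N := para_num (l w w') (l (p 0 ix) (q 0 ix)) (l (p 0 iy) (q 0 iy)) (l (p 0 iu) (q 0 iu)).
pose D := para_den (l w w') (l (p 0 ix) (q 0 ix)).
have NE t j : (N j).[t] = para_num (l w w').[t] (l (p 0 ix) (q 0 ix)).[t]
    (l (p 0 iy) (q 0 iy)).[t] (l (p 0 iu) (q 0 iu)).[t] j.
  exact: (para_num_morph (horner_eval t)).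
have DE t : D.[t] = para_den (l w w').[t] (l (p 0 ix) (q 0 ix)).[t].
  exact: (para_den_morph (horner_eval t)).
have D0 : D.[0] != 0 by rewrite DE !l0.
have D1 : D.[1] != 0 by rewrite DE !l1.
have [P [k HP]] := meval_horner_frac g N D; have [Q [m HQ]] := meval_horner_frac h N D.
have : P * Q * D = 0.
  apply: poly_eq0_of_horner => t; rewrite 2!hornerM.
  have [->|Dt] := eqVneq D.[t] 0; first by rewrite mulr0.
  rewrite -HP// -HQ// mulrACA -mevalM -gh (_ : _.@[_] = 0) ?mul0r//.
  have := para_zero (w := (l w w').[t]) (x := (l (p 0 ix) (q 0 ix)).[t])
    (l (p 0 iy) (q 0 iy)).[t] (l (p 0 iu) (q 0 iu)).[t].
  rewrite -DE => /(_ Dt) <-; apply: meval_eq => j; by rewrite NE.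
have P1 : P.[1] != 0.
  rewrite -HP// mulf_neq0 ?expf_neq0//; apply/eqP => gq; apply: (factor_disjoint (p := q)) => //.
  by rewrite -gq; apply: meval_eq => j; rewrite NE DE !l1 -qE.
have Q0 : Q.[0] != 0.
  rewrite -HQ// mulf_neq0 ?expf_neq0//; apply/eqP => hp; apply: (factor_disjoint (p := p)) => //.
  by rewrite -hp; apply: meval_eq => j; rewrite NE DE !l0 -pE.
move=> /eqP; rewrite 2!mulf_eq0 -orbA => /or3P[] /eqP E.
- by move: P1; rewrite E horner0 eqxx.
- by move: Q0; rewrite E horner0 eqxx.
- by move: D0; rewrite E horner0 eqxx.
Qed.

(** For [x <> 0] the factor [h] has no zero in the [b]-direction, so it does not depend on [b]; as a
    polynomial identity in [x] this extends to [x = 0]. There [b] may be moved to [0], where the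
    whole product is [1]. *)
Lemma factor_nonvanishing : (forall p, p 0 ix != 0 -> h.@[p 0] != 0) -> forall p, h.@[p 0] != 0.
Proof.
move=> hx p; have [px|] := eqVneq (p 0 ix) 0; last exact: hx.
pose q b x : V := vec b x (p 0 iy) (p 0 iz) (p 0 iu).
have qE : q (p 0 ib) 0 = p.
  apply/rowP => -[j Hj]; rewrite mxE; case: j Hj => [|[|[|[|[|j]]]]] //= Hj;
  by rewrite -?px; congr (p 0 _); exact: val_inj.
have q0 : h.@[q 0 0 0] != 0.
  have : (fpoly K).@[q 0 0 0] != 0 by rewrite fpolyE !mxE /= /ff mul0r addr0 oner_neq0.
  by apply: contraNneq => h0; rewrite gh mevalM h0 mulr0.
have qx b x : x != 0 -> h.@[q b x 0] = h.@[q 0 x 0].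
  move=> x0; have [Q HQ] := meval_horner h (fun j => nth 0 [:: 'X; x%:P; (p 0 iy)%:P; (p 0 iz)%:P; (p 0 iu)%:P] j).
  have E t : h.@[q t x 0] = Q.[t].
    rewrite -HQ; apply: meval_eq => -[j Hj]; rewrite mxE.
    by case: j Hj => [|[|[|[|[|j]]]]] //= Hj; rewrite ?hornerX ?hornerC.
  rewrite !E; apply: poly_cst_of_nonroot => t; rewrite -E; apply: hx; by rewrite mxE.
have qP b : exists Q : {poly K}, forall t, h.@[q b t 0] = Q.[t].
  have [Q HQ] := meval_horner h (fun j => nth 0 [:: b%:P; 'X; (p 0 iy)%:P; (p 0 iz)%:P; (p 0 iu)%:P] j).
  exists Q => t; rewrite -HQ; apply: meval_eq => -[j Hj]; rewrite mxE.
  by case: j Hj => [|[|[|[|[|j]]]]] //= Hj; rewrite ?hornerX ?hornerC.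
have [P HP] := qP (p 0 ib); have [Q HQ] := qP 0.
have : (P - Q) * 'X = 0.
  apply: poly_eq0_of_horner => t; rewrite hornerM hornerX hornerD hornerN.
  have [->|t0] := eqVneq t 0; first by rewrite mulr0.
  by rewrite -HP -HQ qx// subrr mul0r.
move=> /eqP; rewrite mulf_eq0 polyX_eq0 orbF subr_eq0 => /eqP PQ.
by rewrite -qE HP PQ -HQ.
Qed.
End Factorization.

Lemma fpoly_irreducible : irreducible_mpoly (fpoly K).
Proof.
have half g h : fpoly K = g * h -> (forall p : V, p 0 ix != 0 -> h.@[p 0] != 0) ->
    h \is a GRing.unit.
  by move=> gh hx; apply: mpoly_nonvanishing_unit; exact: factor_nonvanishing gh hx.
split.
- apply/eqP => f0; have : (fpoly K).@[(0 : V) 0] = 1.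
    by rewrite fpolyE !mxE /ff mul0r addr0.
  by rewrite f0 meval0 => /eqP; rewrite eq_sym oner_eq0.
- have [c fc] := f0_root; have : (fpoly K).@[vec c 0 0 0 0 0] = 0.
    by rewrite fpolyE /sv !mxE /= mul0r /ff mulr0 addr0 mulr1.
  move=> z; apply/negP => /(rmorph_unit (meval (vec c 0 0 0 0 0))); rewrite /= z.
  by rewrite unitr0.
- move=> g h gh; case: (EM (forall p : V, p 0 ix != 0 -> h.@[p 0] != 0)) => [hx|hx].
    by right; exact: half gh hx.
  left; apply: (half h g); first by rewrite mulrC.
  move=> p px; apply/eqP => gp; apply: hx => q qx; apply/eqP => hq.
  exact: (factor_generic gh px qx gp hq).
Qed.
End Irreducible.

(** * The action *)

Section Action.
Variable L : comNzRingType.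
Implicit Types b x y z u t v : L.

(* [(f - f0) / x] as a polynomial in [b], [x] and [v]. *)
Definition cf b x v := b * af b ^+ 11 * v * \sum_(k < 10) (1 + af b * (x * v)) ^+ k.

Lemma ff_cf b x v : ff b (x * v) = f0 b + x * cf b x v.
Proof.
rewrite /cf; set s := \sum_(k < 10) _.
(* The geometric sum extracts the factor [af b * (x * v)] from the difference of [ff] and [f0]. *)
have := subrX1 (1 + af b * (x * v)) 10; rewrite -/s addrAC subrr add0r => e.
have -> : ff b (x * v) = f0 b + b * af b ^+ 10 * ((1 + af b * (x * v)) ^+ 10 - 1).
  by rewrite /ff /f0 exprMn; ring.
by rewrite e; ring.
Qed.

(** Over an arbitrary commutative ring, so that one formula yields both the values of the action and
    the polynomials that define it. *)
Definition mu_coord t b x y z u (j : nat) : L :=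
  nth 0 [:: b; x; y + t; z - t * cf b x (vf b x y z); u] j.

Definition mu t (p : 'rV[L]_5) : 'rV[L]_5 :=
  \row_j mu_coord t (p 0 ib) (p 0 ix) (p 0 iy) (p 0 iz) (p 0 iu) j.

Lemma vf_mu t (p : 'rV[L]_5) : ff (p 0 ib) (sv p) = 0 ->
  vf (mu t p 0 ib) (mu t p 0 ix) (mu t p 0 iy) (mu t p 0 iz) =
  vf (p 0 ib) (p 0 ix) (p 0 iy) (p 0 iz).
Proof.
rewrite /sv ff_cf; set v := vf _ _ _ _ => e; rewrite !mxE /mu_coord /= -/v.
transitivity (v + t * (f0 (p 0 ib) + p 0 ix * cf (p 0 ib) (p 0 ix) v)); last by rewrite e mulr0 addr0.
by move: (cf _ _ v) => w; rewrite /v /vf; ring.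
Qed.
End Action.

Lemma mu_coord_morph (L M : comNzRingType) (phi : {rmorphism L -> M}) t b x y z u j :
  phi (mu_coord t b x y z u j) = mu_coord (phi t) (phi b) (phi x) (phi y) (phi z) (phi u) j.
Proof.
rewrite /mu_coord /cf; case: j => [|[|[|[|[|j]]]]] //=; rewrite ?nth_nil ?rmorph0 ?rmorphD//.
congr (_ + _); rewrite rmorphN 4!rmorphM rmorphXn af_morph vf_morph rmorph_sum; congr (- (_ * (_ * _))).
by apply: eq_bigr => k _; rewrite rmorphXn rmorphD rmorph1 rmorphM af_morph rmorphM vf_morph.
Qed.

Section AdditiveAction.
Variable K : numClosedFieldType.
Local Notation V := 'rV[K]_5.

Definition hyp : set V := [set p | (fpoly K).@[p 0] = 0].

Lemma hypE p : hyp p -> ff (p 0 ib) (sv p) = 0.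
Proof. by rewrite /hyp /= fpolyE. Qed.

Lemma hyp_smooth_irreducible : smooth_irreducible_hypersurface hyp.
Proof. by exists (fpoly K); split => //; [exact: fpoly_irreducible|exact: fpoly_smooth]. Qed.

Lemma hyp_mu t p : hyp p -> hyp (mu t p).
Proof.
move=> Hp; rewrite /hyp /= fpolyE /sv vf_mu ?hypE// [mu t p 0 ib]mxE [mu t p 0 ix]mxE.
exact: hypE.
Qed.

Lemma mu_add (s t : K) p : hyp p -> mu (s + t) p = mu s (mu t p).
Proof.
move=> Hp; apply/rowP => -[j Hj]; have v := vf_mu t (hypE Hp).
rewrite [RHS]mxE /mu_coord v !mxE /mu_coord.
by case: j Hj => [|[|[|[|[|j]]]]] //= Hj; ring.
Qed.

Lemma mu0 (p : V) : mu 0 p = p.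
Proof.
apply/rowP => -[j Hj]; rewrite mxE /mu_coord addr0 mul0r subr0.
by case: j Hj => [|[|[|[|[|j]]]]] //= Hj; congr (p 0 _); exact: val_inj.
Qed.

Lemma mu_action : algebraic_additive_action hyp (@mu K).
Proof.
split; [by move=> t p; exact: hyp_mu|by move=> p _; exact: mu0|exact: mu_add|].
(* In the coordinates of [row_mx t%:M x] the first variable is the time, and the other five are
   those of the point. *)
pose X (j : 'I_5) : {mpoly K[1 + 5]} := 'X_(rshift 1 j).
pose P (j : 'I_5) := mu_coord 'X_(lshift 5 (0 : 'I_1)) (X ib) (X ix) (X iy) (X iz) (X iu) j.
exists (fun w => \row_j (P j).@[w 0]); first by exists P => w j; rewrite mxE.
move=> t p _; apply/rowP => j; rewrite !mxE (mu_coord_morph (meval _)) /= !mevalXU.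
by rewrite row_mxEl !row_mxEr mxE eqxx mulr1n.
Qed.
End AdditiveAction.

Theorem theorem1 (R : realType) :
  exists (H : set 'rV[R[i]]_5) (mu : R[i] -> 'rV[R[i]]_5 -> 'rV[R[i]]_5),
    [/\ smooth_irreducible_hypersurface H,
        algebraic_additive_action H mu &
        forall t : R[i], t != 0 ->
          ~ (exists phi : 'rV[R[i]]_5 -> 'rV[R[i]]_5,
               algebraic_automorphism phi /\
               (forall x, H x -> phi x = mu t x)) /\
          ~ (exists phi : 'rV[R[i]]_5 -> 'rV[R[i]]_5,
               holomorphic_automorphism phi /\
               (forall x, H x -> phi x = mu t x))].
Proof.
exists (@hyp R[i]), (@mu R[i]); split; [exact: hyp_smooth_irreducible|exact: mu_action|].
move=> t t0.
have no_ext : ~ (exists phi : 'rV[R[i]]_5 -> 'rV[R[i]]_5,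
    holomorphic_automorphism phi /\ (forall x, hyp x -> phi x = mu t x)).
  move=> [F [[G [dF dG FK GK]] FE]].
  have ffH (p : 'rV[R[i]]_5) : ff (p 0 ib) (sv p) = 0 -> hyp p by rewrite /hyp /= fpolyE.
  have [c fc] := f0_root R[i].
  have Hc : hyp (vec c 0 0 0 0).
    by apply: ffH; rewrite /sv !mxE /= mul0r /ff mulr0 addr0 mulr1.
  (* The inverse extends [mu (- t)], so it preserves the hypersurface as well, as [rigidity]
     requires. *)
  have GE p : hyp p -> G p = mu (- t) p.
    move=> Hp; have Hm : hyp (mu (- t) p) by exact: hyp_mu.
    by rewrite -[RHS]FK (FE _ Hm) -mu_add// subrr mu0.
  have GH (p : 'rV[R[i]]_5) : ff (p 0 ib) (sv p) = 0 -> ff (G p 0 ib) (sv (G p)) = 0.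
    by move=> /ffH Hp; rewrite (GE _ Hp); apply/hypE/hyp_mu.
  have FH (p : 'rV[R[i]]_5) : ff (p 0 ib) (sv p) = 0 -> ff (F p 0 ib) (sv (F p)) = 0 /\ F p 0 ib = p 0 ib.
    by move=> /ffH Hp; rewrite (FE _ Hp); split; [apply/hypE/hyp_mu|rewrite mxE].
  have := rigidity FK GK dF dG GH FH fc.
  by rewrite (FE _ Hc) !mxE /mu_coord /= add0r => /eqP; rewrite (negbTE t0).
split => // -[F [aF FE]]; apply: no_ext; exists F; split => //.
exact: algebraic_holomorphic.
Qed.
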